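(* Let $c\in\mathbb{C}$. Suppose that $(W,Y_W)$ is a weak $(\sigma,\rho)$-deformed $\phi$-coordinated $\mathcal{V}^c(\mathfrak{gl}_N)$-module such that for all $i,j=1,\ldots,N$ $$Y_W(t_{ij}^{(-1)}\mathbf{1},z)\in z^{-1}\,\mathrm{End}\,W\,[[z]].$$ Then the assignments $$(\ell_{ij})_W=\mathrm{Res}_z\,Y_W(t_{ij}^{(-1)}\mathbf{1},z),\qquad i,j=1,\ldots,N,$$ define a structure of $\mathcal{O}_h(Mat_N)$-module over $W$.
   Context: **Conventions.** $h$ is a formal parameter, $N$ a fixed positive integer, and $e_{ij}\in\mathrm{End}\,\mathbb{C}^N$ are matrix units. A $\mathbb{C}[[h]]$-module $V$ is topologically free if $V=V_0[[h]]$ for a complex vector space $V_0$; then $V((z))_h=V_0((z))[[h]]$. All tensor products are $h$-adically completed. Subscripts/superscripts on matrices indicate tensor factors. $\prod^{\rightarrow}$, $\prod^{\leftarrow}$ denote ordered products with indices increasing, resp. decreasing, from left to right. $\mathrm{Res}_z$ is the coefficient of $z^{-1}$. **$R$-matrices.** $P=\sum_{i,j}e_{ij}\otimes e_{ji}$, $$R=e^{h/2}\sum_i e_{ii}\otimes e_{ii}+\sum_{i\ne j}e_{ii}\otimes e_{jj}+(e^{h/2}-e^{-h/2})\sum_{i<j}e_{ij}\otimes e_{ji},\qquad \overline R(z)=R+\frac{(e^{h/2}-e^{-h/2})z}{1-z}P,$$ $$R(z)=\frac{e^{-h/2}(1-z)f(z)}{1-ze^{-h}}\,\overline R(z),$$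 where $f(z)=f_q(z)|_{q=e^{h/2}}$ and $f_q(z)=1+\sum_{r\ge1}f_{q,r}\frac{z^r}{(1-z)^r}\in\mathbb{C}(q)[[z]]$ is the unique series of this form with all $f_{q,r}(q-1)^{-r}$ regular at $q=1$ and $f_q(zq^{2N})=f_q(z)(1-zq^2)(1-zq^{2N-2})(1-z)^{-1}(1-zq^{2N})^{-1}$. $R(z)$ is regarded as an element of $\mathrm{End}\,\mathbb{C}^N\otimes\mathrm{End}\,\mathbb{C}^N\otimes\mathbb{C}(z)[[h]]$; $R(e^u)$ is obtained by putting $z=e^u$ and expanding in $\mathbb{C}((u))[[h]]$. $R_{21}=PRP$, $R_{21}(z)=PR(z)P$. For $u=(u_1,\dots,u_n)$, $v=(v_1,\dots,v_m)$, $a\in\mathbb{C}$ put $$R^{12}_{nm}(ze^{u-v+ah})=\prod_{r=1,\dots,n}^{\rightarrow}\ \prod_{s=n+1,\dots,n+m}^{\leftarrow}R_{rs}(ze^{u_r-v_{s-n}+ah}),\qquad R^{12}_{nm}=\prod_{r=1,\dots,n}^{\rightarrow}\ \prod_{s=n+1,\dots,n+m}^{\leftarrow}R_{rs}$$ (expanded in nonnegative powers of the $u_i,v_j$), and let $R^{21}_{nm}(\cdot)$, $R^{21}_{nm}$ be the products of the $P$-conjugated factors in the opposite order, e.g. $R^{21}_{nm}=\prod^{\leftarrow}_{r}\prod^{\rightarrow}_{s}R_{sr}$. $(R^{12}_{nm})'$ and $(R^{21}_{nm})'$ are the inverses of $R^{12}_{nm}$, $R^{21}_{nm}$ with respect to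 the multiplication of $((\mathrm{End}\,\mathbb{C}^N)^{\mathrm{op}})^{\otimes n}\otimes(\mathrm{End}\,\mathbb{C}^N)^{\otimes m}$ (they exist). ''$\cdot_{LR}$'' is the multiplication in $(\mathrm{End}\,\mathbb{C}^N)^{\otimes n}\otimes((\mathrm{End}\,\mathbb{C}^N)^{\mathrm{op}})^{\otimes m}$ and ''$\cdot_{RL}$'' is the multiplication in $((\mathrm{End}\,\mathbb{C}^N)^{\mathrm{op}})^{\otimes n}\otimes(\mathrm{End}\,\mathbb{C}^N)^{\otimes m}$. **$\mathcal{V}^c(\mathfrak{gl}_N)$.** $U(R)$ is the unital associative $\mathbb{C}[[h]]$-algebra with unit $\mathbf 1$, generators $t_{ij}^{(-r)}$ ($1\le i,j\le N$, $r\ge1$) and relations $R(e^{u-v})T_1^+(u)T_2^+(v)=T_2^+(v)T_1^+(u)R(e^{u-v})$, where $T^+(u)=\sum_{i,j}e_{ij}\otimes t_{ij}^+(u)$, $t^+_{ij}(u)=\delta_{ij}-h\sum_{r\ge1}t_{ij}^{(-r)}u^{r-1}$. As a $\mathbb{C}[[h]]$-module, $\mathcal{V}^c(\mathfrak{gl}_N)$ is the $h$-adic completion of $U(R)$. $T^+(u)$ acts on it by multiplication, and $T^-(u)\in \mathrm{End}\,\mathbb{C}^N\otimes\mathrm{Hom}(\mathcal{V}^c(\mathfrak{gl}_N),\mathcal{V}^c(\mathfrak{gl}_N)((u))_h)$ is the unique (invertible) operator series with $$T^-_0(u)T_1^+(v_1)\cdots T_n^+(v_n)\mathbf1=R^{01}_{1n}(e^{u-v+hc/2})^{-1}\,T_1^+(v_1)\cdots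 T_n^+(v_n)\,R^{01}_{1n}(e^{u-v-hc/2})\mathbf 1,\quad n\ge0 .$$ Write $T^\pm_{[n]}(u)=T_1^\pm(u_1)\cdots T_n^\pm(u_n)$ and $T^\pm_{[n]}(z|u)=T_1^\pm(z+u_1)\cdots T_n^\pm(z+u_n)$. By a theorem of Etingof and Kazhdan, $\mathcal{V}^c(\mathfrak{gl}_N)$ is an ($h$-adic) quantum vertex algebra with vacuum $\mathbf1$ and vertex operator map $Y(T^+_{[n]}(u)\mathbf1,z)=T^+_{[n]}(z|u)\,T^-_{[n]}(z+hc/2|u)^{-1}$. **The maps $\sigma,\rho$.** $\sigma(z),\rho(z):\mathcal{V}^c(\mathfrak{gl}_N)^{\otimes2}\to\mathcal{V}^c(\mathfrak{gl}_N)^{\otimes2}\otimes\mathbb{C}(z)[[h]]$ are the unique $\mathbb{C}[[h]]$-module maps such that for all $n,m$ (superscript 1: matrix factors $1,\dots,n$; 2: matrix factors $n+1,\dots,n+m$; 3,4: the two copies of $\mathcal{V}^c(\mathfrak{gl}_N)$) $$\sigma(z)\big(T^{+13}_{[n]}(u)T^{+24}_{[m]}(v)(\mathbf1\otimes\mathbf1)\big)=(R^{12}_{nm})'\cdot_{LR}\big(R^{12}_{nm}(ze^{u-v})T^{+13}_{[n]}(u)R^{21}_{nm}T^{+24}_{[m]}(v)R^{21}_{nm}(ze^{u-v})^{-1}(\mathbf1\otimes\mathbf1)\big),$$ $$\rho(z)\big(T^{+13}_{[n]}(u)T^{+24}_{[m]}(v)(\mathbf1\otimes\mathbf1)\big)=(R^{21}_{nm})'\cdot_{RL}\big(T^{+13}_{[n]}(u)R^{12}_{nm}(ze^{u-v+hc})^{-1}T^{+24}_{[m]}(v)R^{12}_{nm}(ze^{u-v})R^{21}_{nm}(\mathbf1\otimes\mathbf1)\big).$$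 Put $Y^\rho(z)=Y(z)\,\rho(e^z)$, where $\rho(e^z)$ is $\rho(x)|_{x=e^z}$ expanded in $\mathbb{C}((z))[[h]]$; $Y^\rho(u,z)v=Y^\rho(z)(u\otimes v)$. **Modules.** A weak $(\sigma,\rho)$-deformed $\phi$-coordinated $\mathcal{V}^c(\mathfrak{gl}_N)$-module (with $\phi(z_2,z_0)=z_2e^{z_0}$) is a pair $(W,Y_W)$ with $W$ a topologically free $\mathbb{C}[[h]]$-module and $Y_W(\cdot,z):\mathcal{V}^c(\mathfrak{gl}_N)\otimes W\to W((z))_h$ a $\mathbb{C}[[h]]$-module map, $Y_W(z)(v\otimes w)=Y_W(v,z)w$, such that: (i) $Y_W(\mathbf1,z)w=w$ for all $w\in W$; (ii) (weak $\rho$-associativity) for any $u,v\in\mathcal{V}^c(\mathfrak{gl}_N)$ and $n\in\mathbb{Z}_{>0}$ there is $r\in\mathbb{Z}_{\ge0}$ with $(z_1-z_2)^rY_W(u,z_1)Y_W(v,z_2)\in\mathrm{Hom}(W,W((z_1,z_2)))$ mod $h^n$ and $$\big((z_1-z_2)^rY_W(u,z_1)Y_W(v,z_2)\big)\big|^{\mathrm{mod}\ h^n}_{z_1=z_2e^{z_0}}-z_2^r(e^{z_0}-1)^rY_W(Y^\rho(u,z_0)v,z_2)\in h^n\mathrm{Hom}(W,W[[z_0^{\pm1},z_2^{\pm1}]])$$ (the substitution being applied to the expression regarded modulo $h^n$); (iii) ($\sigma$-locality) for any $u,v\in\mathcal{V}^c(\mathfrak{gl}_N)$ and $n\in\mathbb{Z}_{>0}$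 there is $r\in\mathbb{Z}_{\ge0}$ such that for all $w\in W$ $$(z_1-z_2)^rY_W(z_1)(1\otimes Y_W(z_2))\,\iota_{z_1,z_2}\big(\sigma(z_1/z_2)(u\otimes v)\otimes w\big)-(z_1-z_2)^rY_W(v,z_2)Y_W(u,z_1)w\in h^nW[[z_1^{\pm1},z_2^{\pm1}]],$$ where $\iota_{z_1,z_2}:\mathbb{C}(z_1,z_2)[[h]]\hookrightarrow\mathbb{C}((z_1))((z_2))[[h]]$. **Reflection equation algebra.** $\mathcal{O}_h(Mat_N)$ is the $h$-adically completed associative $\mathbb{C}[[h]]$-algebra generated by $\ell_{ij}$, $i,j=1,\dots,N$, subject to $R\,\mathcal{L}_1R_{21}\mathcal{L}_2=\mathcal{L}_2R\,\mathcal{L}_1R_{21}$ with $\mathcal{L}=\sum_{i,j}e_{ij}\otimes\ell_{ij}$. *)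

(* Defs.v *)
From HB Require Import structures.
From mathcomp Require Import all_boot all_order all_algebra.
From mathcomp Require Import generic_quotient fraction.
From mathcomp Require Import boolp classical_sets functions.

Set Implicit Arguments.
Unset Strict Implicit.
Unset Printing Implicit Defensive.

Import GRing.Theory.
Local Open Scope ring_scope.

(* [fps A] is A[[h]], for A a commutative ring or a module W_0 (then [fps W_0]
   is the topologically free module W_0[[h]]).  The same type also serves for
   power series in another variable. *)
Record fps (A : Type) := Fps { fcoef : nat -> A }.

HB.instance Definition _ (A : Type) := gen_eqMixin (fps A).
HB.instance Definition _ (A : Type) := gen_choiceMixin (fps A).

Lemma fpsP (A : Type) (f g : fps A) : (forall n, fcoef f n = fcoef g n) <-> f = g.
Proof.
split=> [|-> //]; case: f => f; case: g => g /= fg.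
by congr Fps; apply: funext.
Qed.

Section FpsZmod.
Variable W : zmodType.
Implicit Types f g : fps W.

Definition fps_zero : fps W := Fps (fun=> 0).
Definition fps_opp f : fps W := Fps (fun n => - fcoef f n).
Definition fps_add f g : fps W := Fps (fun n => fcoef f n + fcoef g n).

Fact fps_addA : associative fps_add.
Proof. by move=> f g k; apply/fpsP => n /=; rewrite addrA. Qed.
Fact fps_addC : commutative fps_add.
Proof. by move=> f g; apply/fpsP => n /=; rewrite addrC. Qed.
Fact fps_add0 : left_id fps_zero fps_add.
Proof. by move=> f; apply/fpsP => n /=; rewrite add0r. Qed.
Fact fps_addN : left_inverse fps_zero fps_opp fps_add.
Proof. by move=> f; apply/fpsP => n /=; rewrite addNr. Qed.

HB.instance Definition _ := GRing.isZmodule.Build (fps W)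
  fps_addA fps_addC fps_add0 fps_addN.
End FpsZmod.

Section FpsConv.
Variables (A : comNzRingType) (W : lmodType A).

Definition fps_conv (a : fps A) (w : fps W) : fps W :=
  Fps (fun n => \sum_(i < n.+1) fcoef a i *: fcoef w (n - i)).

Definition fps_const (X : zmodType) (x : X) : fps X :=
  Fps (fun n => if n == 0%N then x else 0).

Fact fps_conv1 : left_id (fps_const 1) fps_conv.
Proof.
move=> w; apply/fpsP => n /=; rewrite big_ord_recl /= scale1r subn0.
by rewrite big1 ?addr0 // => i _; rewrite scale0r.
Qed.

Fact fps_convDr : right_distributive fps_conv +%R.
Proof.
move=> a v w; apply/fpsP => n /=; rewrite -big_split.
by apply: eq_bigr => i _; rewrite scalerDr.
Qed.

Fact fps_convDl w : {morph fps_conv^~ w : a b / a + b}.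
Proof.
move=> a b; apply/fpsP => n /=; rewrite -big_split.
by apply: eq_bigr => i _; rewrite scalerDl.
Qed.

End FpsConv.

Lemma fps_convA (A : comNzRingType) (W : lmodType A) (a b : fps A) (w : fps W) :
  fps_conv a (fps_conv b w) = fps_conv (fps_conv (W := A^o) a b) w.
Proof.
apply/fpsP => n /=.
pose F i j := (fcoef a j * fcoef b (i - j)) *: fcoef w (n - i).
transitivity (\sum_(j < n.+1) \sum_(i < n.+1 | (j <= i)%N) F i j); last first.
  rewrite (exchange_big_dep predT) //=; apply: eq_bigr => i _.
  rewrite scaler_suml (big_ord_widen n.+1 (F i)) //; exact: ltn_ord.
apply: eq_bigr => j _; rewrite scaler_sumr.
rewrite -(big_mkord xpredT (fun k =>
  fcoef a j *: (fcoef b k *: fcoef w (n - j - k)))).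
rewrite -(big_mkord (fun i => (j <= i)%N) (fun i => F i j)).
rewrite [RHS](big_cat_nat (n := j)) //=; last exact: ltnW (ltn_ord j).
rewrite [X in _ = X + _]big_nat_cond [X in _ = X + _]big1 ?add0r; last first.
  by move=> i /andP[/andP[_ ij]]; rewrite leqNgt ij.
rewrite -[X in \big[_/_]_(X <= _ < n.+1 | _) _]add0n big_addn.
rewrite subSn ?leq_ord // big_mkord [RHS]big_mkcond big_mkord.
apply: eq_bigr => k _.
by rewrite leq_addl /F addnK scalerA addnC subnDA.
Qed.

Section FpsRing.
Variable A : comNzRingType.
Implicit Types f g : fps A.

Definition fps_mul f g : fps A := fps_conv (W := A^o) f g.

Fact fps_mulA : associative fps_mul.
Proof. by move=> f g k; apply: (fps_convA (W := A^o)). Qed.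
Fact fps_mulC : commutative fps_mul.
Proof.
move=> f g; apply/fpsP => n /=; rewrite (reindex_inj rev_ord_inj) /=.
by apply: eq_bigr => i _; rewrite subSS subKn ?leq_ord // /GRing.scale /= mulrC.
Qed.
Fact fps_mul1 : left_id (fps_const 1) fps_mul.
Proof. exact: (fps_conv1 (W := A^o)). Qed.
Fact fps_mulDl : left_distributive fps_mul +%R.
Proof. by move=> f g k; apply: (fps_convDl (W := A^o)). Qed.
Fact fps_oner_neq0 : fps_const 1 != 0 :> fps A.
Proof.
by apply/eqP => /fpsP/(_ 0%N) /= /eqP; rewrite oner_eq0.
Qed.

HB.instance Definition _ := GRing.Zmodule_isComNzRing.Build (fps A)
  fps_mulA fps_mulC fps_mul1 fps_mulDl fps_oner_neq0.

Definition fps_unit : {pred fps A} := fun f => `[< exists g, g * f = 1 >].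
Definition fps_inv f : fps A := xget f [set g | g * f = 1].

Fact fps_mulVr : {in fps_unit, left_inverse 1 fps_inv *%R}.
Proof. by move=> f /asboolP ?; apply: (@xgetPex _ f [set g | g * f = 1]). Qed.
Fact fps_unitPl f g : g * f = 1 -> fps_unit f.
Proof. by move=> gf; apply/asboolP; exists g. Qed.
Fact fps_inv_out : {in [predC fps_unit], fps_inv =1 id}.
Proof.
move=> f; rewrite inE => /negP nf; rewrite /fps_inv; case: xgetP => // g _ gf.
by case: nf; apply: fps_unitPl gf.
Qed.

HB.instance Definition _ := GRing.ComNzRing_hasMulInverse.Build (fps A)
  fps_mulVr fps_unitPl fps_inv_out.

End FpsRing.

HB.instance Definition _ (A : comNzRingType) (W : lmodType A) :=
  GRing.Zmodule_isLmodule.Build (fps A) (fps W)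
    (@fps_convA A W) (@fps_conv1 A W) (@fps_convDr A W) (@fps_convDl A W).

Definition fps_mon (A : zmodType) (a : A) (n : nat) : fps A :=
  Fps (fun k => if k == n then a else 0).
Definition fps_X (A : comNzRingType) : fps A := fps_mon 1 1.
Definition fps_map (A B : Type) (g : A -> B) (f : fps A) : fps B :=
  Fps (fun n => g (fcoef f n)).

(** The series e^{a h}. *)
Definition fps_exp (C : fieldType) (a : C) : fps C :=
  Fps (fun n => a ^+ n / (n`!)%:R).

Section Hadic.
Variables (A : comNzRingType) (M : lmodType (fps A)).

Definition hdvd (n : nat) (x : M) : Prop := exists y : M, x = fps_mon 1 n *: y.

(** Unconditional convergence of the family [x] to [s], modulo h^n and in the
    h-adic topology. *)
Definition hsums_mod (n : nat) (I : eqType) (x : I -> M) (s : M) : Prop :=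
  exists J : seq I, forall J' : seq I, uniq J' -> {subset J <= J'} ->
    hdvd n (s - \sum_(i <- J') x i).
Definition hsums (I : eqType) (x : I -> M) (s : M) : Prop :=
  forall n, hsums_mod n x s.
Definition hsum (I : eqType) (x : I -> M) : M := xget 0 [set s | hsums x s].

(** A doubly infinite series sum_k x_k z^k over M belongs to M((z))_h. *)
Definition hlaurent (x : int -> M) : Prop :=
  forall n, exists K : int, forall k : int, (k < K)%R -> hdvd n (x k).

End Hadic.

(** [tw_eq S n] is a congruence on [S], whose quotient S_n is a module over
    A[[h]]; [hlim S] below is the limit of the S_n. *)
Record tower (A : comNzRingType) := Tower {
  tw_car :> Type;
  tw_eq : nat -> tw_car -> tw_car -> Prop;
  tw_zero : tw_car;
  tw_add : tw_car -> tw_car -> tw_car;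
  tw_scale : fps A -> tw_car -> tw_car;
  tw_refl : forall n x, tw_eq n x x;
  tw_sym : forall n x y, tw_eq n x y -> tw_eq n y x;
  tw_trans : forall n x y z, tw_eq n x y -> tw_eq n y z -> tw_eq n x z;
  tw_eq_add : forall n x x' y y', tw_eq n x x' -> tw_eq n y y' ->
    tw_eq n (tw_add x y) (tw_add x' y');
  tw_eq_scale : forall n a x x', tw_eq n x x' ->
    tw_eq n (tw_scale a x) (tw_scale a x');
  tw_addA : forall n x y z,
    tw_eq n (tw_add x (tw_add y z)) (tw_add (tw_add x y) z);
  tw_addC : forall n x y, tw_eq n (tw_add x y) (tw_add y x);
  tw_add0 : forall n x, tw_eq n (tw_add tw_zero x) x;
  tw_addN : forall n x, tw_eq n (tw_add (tw_scale (-1) x) x) tw_zero;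
  tw_scaleA : forall n a b x,
    tw_eq n (tw_scale a (tw_scale b x)) (tw_scale (a * b) x);
  tw_scale1 : forall n x, tw_eq n (tw_scale 1 x) x;
  tw_scaleDr : forall n a x y,
    tw_eq n (tw_scale a (tw_add x y)) (tw_add (tw_scale a x) (tw_scale a y));
  tw_scaleDl : forall n a b x,
    tw_eq n (tw_scale (a + b) x) (tw_add (tw_scale a x) (tw_scale b x))
}.

Record alg_tower (A : comNzRingType) := AlgTower {
  at_tower :> tower A;
  at_one : at_tower;
  at_mul : at_tower -> at_tower -> at_tower;
  at_eq_mul : forall n x x' y y', tw_eq n x x' -> tw_eq n y y' ->
    tw_eq n (at_mul x y) (at_mul x' y');
  at_mulA : forall n x y z,
    tw_eq n (at_mul x (at_mul y z)) (at_mul (at_mul x y) z);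
  at_mul1l : forall n x, tw_eq n (at_mul at_one x) x;
  at_mul1r : forall n x, tw_eq n (at_mul x at_one) x;
  at_mulDl : forall n x y z,
    tw_eq n (at_mul (tw_add x y) z) (tw_add (at_mul x z) (at_mul y z));
  at_mulDr : forall n x y z,
    tw_eq n (at_mul x (tw_add y z)) (tw_add (at_mul x y) (at_mul x z));
}.

Section Limit.
Variables (A : comNzRingType) (S : tower A).

Record thread := Thread {
  th_seq :> nat -> S;
  th_coh : forall n, tw_eq n (th_seq n.+1) (th_seq n)
}.
HB.instance Definition _ := gen_eqMixin thread.
HB.instance Definition _ := gen_choiceMixin thread.

Definition th_eqv (s t : thread) : bool := `[< forall n, tw_eq n (s n) (t n) >].

Fact th_eqv_refl : reflexive th_eqv.
Proof. by move=> s; apply/asboolP => n; apply: tw_refl. Qed.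
Fact th_eqv_sym : symmetric th_eqv.
Proof.
by move=> s t; apply/asboolP/asboolP => st n; apply: tw_sym; apply: st.
Qed.
Fact th_eqv_trans : transitive th_eqv.
Proof.
move=> t s r /asboolP st /asboolP tr; apply/asboolP => n.
exact: tw_trans (st n) (tr n).
Qed.

Canonical th_eqv_rel := EquivRel th_eqv th_eqv_refl th_eqv_sym th_eqv_trans.

Definition hlim := {eq_quot th_eqv}%qT.
HB.instance Definition _ : EqQuotient _ th_eqv hlim := EqQuotient.on hlim.
HB.instance Definition _ := Choice.on hlim.

Lemma hlim_eqP (s t : thread) :
  (\pi_hlim s = \pi_hlim t)%qT <-> forall n, tw_eq n (s n) (t n).
Proof.
split=> [/eqmodP/asboolP //|st]; apply/eqmodP; exact/asboolP.
Qed.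

Lemma hlim_reprP (s : thread) n : tw_eq n (repr (\pi_hlim s)%qT n) (s n).
Proof. by apply: (hlim_eqP _ _).1; rewrite reprK. Qed.

Ltac lim_step := apply: tw_trans; first by
  first [apply: tw_eq_add | apply: tw_eq_scale];
  first [exact: hlim_reprP | exact: tw_refl].
Ltac lim_done := apply: tw_eq_add; apply: tw_sym;
  first [exact: tw_refl | exact: hlim_reprP].

Definition th_zero := Thread (fun n => tw_refl n (tw_zero S)).
Definition th_add (s t : thread) :=
  Thread (fun n => tw_eq_add (th_coh s n) (th_coh t n)).
Definition th_scale (a : fps A) (s : thread) :=
  Thread (fun n => tw_eq_scale a (th_coh s n)).

Definition hlim_zero : hlim := (\pi_hlim th_zero)%qT.
Definition hlim_add (x y : hlim) : hlim := (\pi_hlim (th_add (repr x) (repr y)))%qT.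
Definition hlim_scale (a : fps A) (x : hlim) : hlim :=
  (\pi_hlim (th_scale a (repr x)))%qT.
Definition hlim_opp := hlim_scale (-1).

Fact hlim_addA : associative hlim_add.
Proof.
move=> x y z; apply/hlim_eqP => n /=; lim_step.
by apply: tw_trans; [apply: tw_addA | lim_done].
Qed.
Fact hlim_addC : commutative hlim_add.
Proof. by move=> x y; apply/hlim_eqP => n; apply: tw_addC. Qed.
Fact hlim_add0 : left_id hlim_zero hlim_add.
Proof.
move=> x; rewrite -[RHS]reprK; apply/hlim_eqP => n /=; lim_step.
exact: tw_add0.
Qed.
Fact hlim_addN : left_inverse hlim_zero hlim_opp hlim_add.
Proof. by move=> x; apply/hlim_eqP => n /=; lim_step; apply: tw_addN. Qed.

HB.instance Definition _ := GRing.isZmodule.Build hlim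
  hlim_addA hlim_addC hlim_add0 hlim_addN.

Fact hlim_scaleA a b x : hlim_scale a (hlim_scale b x) = hlim_scale (a * b) x.
Proof. by apply/hlim_eqP => n /=; lim_step; apply: tw_scaleA. Qed.
Fact hlim_scale1 : left_id 1 hlim_scale.
Proof.
by move=> x; rewrite -[RHS]reprK; apply/hlim_eqP => n; apply: tw_scale1.
Qed.
Fact hlim_scaleDr : right_distributive hlim_scale +%R.
Proof.
move=> a x y; apply/hlim_eqP => n /=; lim_step.
by apply: tw_trans; [apply: tw_scaleDr | lim_done].
Qed.
Fact hlim_scaleDl x : {morph hlim_scale^~ x : a b / a + b}.
Proof.
move=> a b; apply/hlim_eqP => n /=.
by apply: tw_trans; [apply: tw_scaleDl | lim_done].
Qed.

HB.instance Definition _ := GRing.Zmodule_isLmodule.Build (fps A) hlim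
  hlim_scaleA hlim_scale1 hlim_scaleDr hlim_scaleDl.

Definition hlim_in (x : S) : hlim :=
  (\pi_hlim (Thread (fun n => tw_refl n x)))%qT.

End Limit.

Section LimitAlgebra.
Variables (A : comNzRingType) (S : alg_tower A).

Definition alim : Type := hlim S.
HB.instance Definition _ := GRing.Lmodule.on alim.

Definition th_mul (s t : thread S) :=
  Thread (fun n => at_eq_mul (th_coh s n) (th_coh t n)).
Definition alim_one : alim := hlim_in (at_one S).
Definition alim_mul (x y : alim) : alim := (\pi_(hlim S) (th_mul (repr x) (repr y)))%qT.

Ltac lim_step := apply: tw_trans; first by
  apply: at_eq_mul; first [exact: hlim_reprP | exact: tw_refl].
Ltac lim_done := first [apply: tw_eq_add | apply: at_eq_mul]; apply: tw_sym;
  first [exact: tw_refl | exact: hlim_reprP].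

Fact alim_mulA : associative alim_mul.
Proof.
move=> x y z; apply/hlim_eqP => n /=; lim_step.
by apply: tw_trans; [apply: at_mulA | lim_done].
Qed.
Fact alim_mul1l : left_id alim_one alim_mul.
Proof.
move=> x; rewrite -[RHS]reprK; apply/hlim_eqP => n /=; lim_step.
exact: at_mul1l.
Qed.
Fact alim_mul1r : right_id alim_one alim_mul.
Proof.
move=> x; rewrite -[RHS]reprK; apply/hlim_eqP => n /=; lim_step.
exact: at_mul1r.
Qed.
Fact alim_mulDl : left_distributive alim_mul +%R.
Proof.
move=> x y z; apply/hlim_eqP => n /=; lim_step.
by apply: tw_trans; [apply: at_mulDl | lim_done].
Qed.
Fact alim_mulDr : right_distributive alim_mul +%R.
Proof.
move=> x y z; apply/hlim_eqP => n /=; lim_step.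
by apply: tw_trans; [apply: at_mulDr | lim_done].
Qed.

HB.instance Definition _ := GRing.Zmodule_isPzRing.Build alim
  alim_mulA alim_mul1l alim_mul1r alim_mulDl alim_mulDr.

End LimitAlgebra.

(* The tower A[[h]]<X> / (h^n, rel n).  The relations may depend on n, so that
   h-adically convergent relations can be truncated at each level. *)
Section PresentedAlgebra.
Variables (A : comNzRingType) (X : Type).

Inductive alg_term :=
  | AGen of X
  | ACst of fps A
  | AAdd of alg_term & alg_term
  | AMul of alg_term & alg_term.

Variable rel : nat -> alg_term -> alg_term -> Prop.

Inductive alg_cong (n : nat) : alg_term -> alg_term -> Prop :=
  | ac_refl x : alg_cong n x x
  | ac_sym x y : alg_cong n x y -> alg_cong n y x
  | ac_trans x y z : alg_cong n x y -> alg_cong n y z -> alg_cong n x z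
  | ac_eq_add x x' y y' : alg_cong n x x' -> alg_cong n y y' ->
      alg_cong n (AAdd x y) (AAdd x' y')
  | ac_eq_mul x x' y y' : alg_cong n x x' -> alg_cong n y y' ->
      alg_cong n (AMul x y) (AMul x' y')
  | ac_addA x y z : alg_cong n (AAdd x (AAdd y z)) (AAdd (AAdd x y) z)
  | ac_addC x y : alg_cong n (AAdd x y) (AAdd y x)
  | ac_add0 x : alg_cong n (AAdd (ACst 0) x) x
  | ac_mulA x y z : alg_cong n (AMul x (AMul y z)) (AMul (AMul x y) z)
  | ac_mul1l x : alg_cong n (AMul (ACst 1) x) x
  | ac_mul1r x : alg_cong n (AMul x (ACst 1)) x
  | ac_mul0 x : alg_cong n (AMul (ACst 0) x) (ACst 0)
  | ac_mulDl x y z :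
      alg_cong n (AMul (AAdd x y) z) (AAdd (AMul x z) (AMul y z))
  | ac_mulDr x y z :
      alg_cong n (AMul x (AAdd y z)) (AAdd (AMul x y) (AMul x z))
  | ac_cstD a b : alg_cong n (ACst (a + b)) (AAdd (ACst a) (ACst b))
  | ac_cstM a b : alg_cong n (ACst (a * b)) (AMul (ACst a) (ACst b))
  | ac_cstC a x : alg_cong n (AMul (ACst a) x) (AMul x (ACst a))
  | ac_h : alg_cong n (ACst (fps_mon 1 n)) (ACst 0)
  | ac_rel x y : rel n x y -> alg_cong n x y.

Definition ascale (a : fps A) (x : alg_term) := AMul (ACst a) x.

Fact ac_eq_scale n a x x' :
  alg_cong n x x' -> alg_cong n (ascale a x) (ascale a x').
Proof. by move=> xx'; apply: ac_eq_mul => //; apply: ac_refl. Qed.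
Fact ac_scaleDl n a b x :
  alg_cong n (ascale (a + b) x) (AAdd (ascale a x) (ascale b x)).
Proof.
apply: ac_trans (ac_mulDl _ _ _ _); apply: ac_eq_mul; last exact: ac_refl.
exact: ac_cstD.
Qed.
Fact ac_addN n x : alg_cong n (AAdd (ascale (-1) x) x) (ACst 0).
Proof.
apply: ac_trans (ac_mul0 n x); rewrite -(addNr 1).
apply: ac_trans (ac_sym (ac_scaleDl _ _ _ _)).
by apply: ac_eq_add; [apply: ac_refl | apply: ac_sym; apply: ac_mul1l].
Qed.
Fact ac_scaleA n a b x :
  alg_cong n (ascale a (ascale b x)) (ascale (a * b) x).
Proof.
apply: ac_trans (ac_mulA _ _ _ _) _; apply: ac_eq_mul; last exact: ac_refl.
by apply: ac_sym; apply: ac_cstM.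
Qed.

Definition presented : alg_tower A :=
  @AlgTower A
    (@Tower A alg_term alg_cong (ACst 0) AAdd ascale
      ac_refl ac_sym ac_trans ac_eq_add ac_eq_scale ac_addA ac_addC ac_add0
      ac_addN ac_scaleA ac_mul1l (fun n a => @ac_mulDr n (ACst a)) ac_scaleDl)
    (ACst 1) AMul ac_eq_mul ac_mulA ac_mul1l ac_mul1r ac_mulDl ac_mulDr.

Definition palg := alim presented.
HB.instance Definition _ := GRing.PzRing.on palg.
HB.instance Definition _ := GRing.Lmodule.on palg.

Definition pgen (x : X) : palg := hlim_in (S := presented) (AGen x).

End PresentedAlgebra.

Section Rational.
Variable C : fieldType.

Definition ratf := {fraction {poly C}}.
HB.instance Definition _ := GRing.Field.on ratf.

Definition tof (p : {poly C}) : ratf := FracField.tofrac p.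
Definition ratc (x : C) : ratf := tof x%:P.
Definition ratz : ratf := tof 'X.

(** z d/dz *)
Definition theta (g : ratf) : ratf :=
  xget 0 [set x | exists p d : {poly C}, [/\ d != 0, g = tof p / tof d &
    x = tof ('X * (p^`() * d - p * d^`())) / tof (d ^+ 2)]].

(** [a] lists the coefficients of the quotient num/den in C((y)). *)
Definition laurent_quot (num den : fps C) (a : int -> C) : Prop :=
  den != 0 /\ exists (e : nat) (F : fps C), den * F = fps_mon 1 e * num /\
    a = fun k : int => if k + e%:Z is Posz n then fcoef F n else 0.

Definition peval (p : {poly C}) (y : fps C) : fps C :=
  \sum_(i < size p) fps_const p`_i * y ^+ i.

(** y^m p(1/y) as a series in y. *)
Definition prev (m : nat) (p : {poly C}) : fps C :=
  Fps (fun i => if (i <= m)%N then p`_(m - i) else 0).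

(** g(e^u) = sum_k (exp_coef g k) u^k in C((u)). *)
Definition exp_coef (g : ratf) : int -> C :=
  xget (fun=> 0) [set a | exists p d : {poly C}, [/\ d != 0, g = tof p / tof d &
    laurent_quot (peval p (fps_exp 1)) (peval d (fps_exp 1)) a]].

(** g(x) = sum_k (inf_coef g k) x^(-k) in C((1/x)). *)
Definition inf_coef (g : ratf) : int -> C :=
  xget (fun=> 0) [set a | exists (p d : {poly C}) (m : nat),
    [/\ d != 0, g = tof p / tof d, (size p <= m.+1)%N, (size d <= m.+1)%N &
        laurent_quot (prev m p) (prev m d) a]].

(** C(z)[[h]], and the coefficientwise extensions to it. *)
Definition ratfh := fps ratf.
HB.instance Definition _ := GRing.ComUnitRing.on ratfh.

Definition emb (a : fps C) : ratfh := fps_map ratc a.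
Definition exp_coefh (G : ratfh) (k : int) : fps C :=
  fps_map (fun g => exp_coef g k) G.
Definition inf_coefh (G : ratfh) (k : int) : fps C :=
  fps_map (fun g => inf_coef g k) G.

(** G(z e^(a h)), by Taylor's formula e^(a h theta) G. *)
Definition hshift (a : C) (G : ratfh) : ratfh :=
  Fps (fun n => \sum_(l < n.+1)
    ratc (a ^+ l / (l`!)%:R) * iter l theta (fcoef G (n - l))).

(** The coefficient of u^p v^q in G(z e^(u - v + a h)). *)
Definition taylor (a : C) (p q : nat) (G : ratfh) : ratfh :=
  fps_map (fun g => ratc ((-1) ^+ q / (p`! * q`!)%:R) * iter (p + q) theta g)
    (hshift a G).

End Rational.

(* The h-adically completed tensor product, as a C(z)[[h]]-module generated by
   the u (x) v. *)
Section TensorSquare.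
Variables (C : fieldType) (V : lmodType (fps C)).

Inductive ten_term :=
  | TPure of V & V
  | TZero
  | TAdd of ten_term & ten_term
  | TScale of ratfh C & ten_term.

Inductive ten_cong (n : nat) : ten_term -> ten_term -> Prop :=
  | tc_refl x : ten_cong n x x
  | tc_sym x y : ten_cong n x y -> ten_cong n y x
  | tc_trans x y z : ten_cong n x y -> ten_cong n y z -> ten_cong n x z
  | tc_eq_add x x' y y' : ten_cong n x x' -> ten_cong n y y' ->
      ten_cong n (TAdd x y) (TAdd x' y')
  | tc_eq_scale g x x' : ten_cong n x x' ->
      ten_cong n (TScale g x) (TScale g x')
  | tc_addA x y z : ten_cong n (TAdd x (TAdd y z)) (TAdd (TAdd x y) z)
  | tc_addC x y : ten_cong n (TAdd x y) (TAdd y x)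
  | tc_add0 x : ten_cong n (TAdd TZero x) x
  | tc_addN x : ten_cong n (TAdd (TScale (-1) x) x) TZero
  | tc_scaleA f g x : ten_cong n (TScale f (TScale g x)) (TScale (f * g) x)
  | tc_scale1 x : ten_cong n (TScale 1 x) x
  | tc_scaleDr g x y :
      ten_cong n (TScale g (TAdd x y)) (TAdd (TScale g x) (TScale g y))
  | tc_scaleDl f g x :
      ten_cong n (TScale (f + g) x) (TAdd (TScale f x) (TScale g x))
  | tc_h x : ten_cong n (TScale (fps_mon 1 n) x) TZero
  | tc_pureDl u u' v :
      ten_cong n (TPure (u + u') v) (TAdd (TPure u v) (TPure u' v))
  | tc_pureDr u v v' :
      ten_cong n (TPure u (v + v')) (TAdd (TPure u v) (TPure u v'))
  | tc_pureZl a u v : ten_cong n (TPure (a *: u) v) (TScale (emb a) (TPure u v))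
  | tc_pureZr a u v : ten_cong n (TPure u (a *: v)) (TScale (emb a) (TPure u v)).

Definition ten_tower : tower (ratf C) :=
  @Tower (ratf C) ten_term ten_cong TZero TAdd TScale
    tc_refl tc_sym tc_trans tc_eq_add tc_eq_scale tc_addA tc_addC tc_add0
    tc_addN tc_scaleA tc_scale1 tc_scaleDr tc_scaleDl.

Definition ten2 := hlim ten_tower.
HB.instance Definition _ := GRing.Lmodule.on ten2.

Definition pure (u v : V) : ten2 := hlim_in (S := ten_tower) (TPure u v).

(** A C[[h]]-module map V (x) V -> V (x) V (x) C(z)[[h]], seen as a bilinear
    map. *)
Definition ten_map (s : V -> V -> ten2) : Prop :=
  (forall v, (forall u u', s (u + u') v = s u v + s u' v) /\
     forall a u, s (a *: u) v = emb a *: s u v) /\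
  (forall u, (forall v v', s u (v + v') = s u v + s u v') /\
     forall a v, s u (a *: v) = emb a *: s u v).

(** The value at [x] of the map V (x) V (x) C(z)[[h]] -> M induced by the
    trilinear map [B]. *)
Definition ten_lift (M : lmodType (fps C)) (B : V -> V -> ratfh C -> M)
    (x : ten2) : M :=
  xget 0 [set s | forall n, exists l : seq (ratfh C * (V * V)),
    hdvd n (x - \sum_(t <- l) t.1 *: pure t.2.1 t.2.2) /\
    hdvd n (s - \sum_(t <- l) B t.2.1 t.2.2 t.1)].

End TensorSquare.

Section Tensors.
Variable N : nat.

Definition idx (k : nat) := {ffun 'I_k -> 'I_N}.
Definition expo (k : nat) := {ffun 'I_k -> nat}.

(** [X i j e] is the coefficient of w_1^(e 1) ... w_k^(e k) in the coefficient
    of e_(i1,j1) (x) ... (x) e_(ik,jk); here w_r is a formal variable attached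
    to the r-th tensor factor. *)
Definition tser (k : nat) (A : Type) := idx k -> idx k -> expo k -> A.

Definition sel k (o : pred 'I_k) (i j : idx k) : idx k :=
  [ffun t => if o t then j t else i t].

(** Product of tensors with entries multiplied by [op], where the tensor
    factors in [o] carry the opposite multiplication of matrices. *)
Definition tmul k (o : pred 'I_k) (A B : Type) (D : zmodType)
    (op : A -> B -> D) (X : tser k A) (Y : tser k B) : tser k D :=
  fun i l e => \sum_(j : idx k)
    \sum_(b : {ffun 'I_k -> 'I_(\sum_t e t).+1} | [forall t, (b t <= e t)%N])
    op (X (sel o i j) (sel o j l) [ffun t => b t : nat])
       (Y (sel o j i) (sel o l j) [ffun t => (e t - b t)%N]).

Definition tone k (A : pzRingType) : tser k A :=
  fun i j e => ((i == j) && [forall t, e t == 0%N])%:R.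

Definition tinv k (o : pred 'I_k) (A : pzRingType) (X : tser k A) : tser k A :=
  xget (fun _ _ _ => 0) [set Y | tmul o *%R X Y = @tone k A /\
                                 tmul o *%R Y X = @tone k A].

Definition tprod k (A : pzRingType) (s : seq (tser k A)) : tser k A :=
  foldr (tmul pred0 *%R) (@tone k A) s.

(** Elements of End C^N (x) End C^N (x) A: [X i j k l] is the coefficient of
    e_ij (x) e_kl; [flip X] is P X P. *)
Definition mat2 (A : Type) := 'I_N -> 'I_N -> 'I_N -> 'I_N -> A.
Definition flip A (X : mat2 A) : mat2 A := fun i j k l => X k l i j.

(** The tensor X_rs, where [X p q] is the coefficient of w_r^p w_s^q. *)
Definition place k (A : zmodType) (X : nat -> nat -> mat2 A) (p : 'I_k * 'I_k) :
    tser k A := let: (r, s) := p in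
  fun i j e => if [forall t, (t \notin [:: r; s]) ==> (i t == j t) && (e t == 0%N)]
    then X (e r) (e s) (i r) (j r) (i s) (j s) else 0.

(** The pairs (r, s) with r = 1, ..., n increasing and, for each r,
    s = n + m, ..., n + 1 decreasing. *)
Definition pairs (n m : nat) : seq ('I_(n + m) * 'I_(n + m)) :=
  [seq (lshift m r, rshift n s) | r <- enum 'I_n, s <- rev (enum 'I_m)].

Definition prod12 n m (A : pzRingType) (F : mat2 A -> nat -> nat -> mat2 A)
    (X : mat2 A) : tser (n + m) A :=
  tprod [seq place (F X) p | p <- pairs n m].
Definition prod21 n m (A : pzRingType) (F : mat2 A -> nat -> nat -> mat2 A)
    (X : mat2 A) : tser (n + m) A :=
  tprod [seq place (F (flip X)) p | p <- rev (pairs n m)].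

Definition constF (A : zmodType) (X : mat2 A) (p q : nat) : mat2 A :=
  if (p + q == 0)%N then X else fun _ _ _ _ => 0.
Definition expF (C : fieldType) (a : C) (X : mat2 (ratfh C)) (p q : nat) :
    mat2 (ratfh C) := fun i j k l => taylor a p q (X i j k l).

(** The factors carrying the opposite multiplication in the products LR, RL. *)
Definition LR n m : pred 'I_(n + m) := fun t => (n <= t)%N.
Definition RL n m : pred 'I_(n + m) := fun t => (t < n)%N.

End Tensors.

Arguments prod12 {N} n m {A} F X.
Arguments prod21 {N} n m {A} F X.

Section RMatrix.
Variables (C : fieldType) (N : nat).

(** The coefficients f_(q,r) in C(q) of the series f_q. *)
Section Normalization.
Variable phi : nat -> ratf C.

Definition fq : fps (ratf C) :=
  Fps (fun k => \sum_(r < k.+1)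
    phi r * fcoef ((fps_X (ratf C) / (1 - fps_X (ratf C))) ^+ r) k).

Definition dilate (b : ratf C) (F : fps (ratf C)) : fps (ratf C) :=
  Fps (fun k => b ^+ k * fcoef F k).

Definition normalizing : Prop :=
  let q := ratz C in
  let lin (b : ratf C) := 1 - fps_mon b 1 in
  [/\ phi 0 = 1,
      forall r, exists p d : {poly C},
        d.[1] != 0 /\ phi r = (q - 1) ^+ r * (tof p / tof d) &
      dilate (q ^+ (2 * N)) fq =
        fq * lin (q ^+ 2) * lin (q ^+ (2 * N - 2)) / lin 1 / lin (q ^+ (2 * N))].

(** g(e^(h/2)), for g in C(q) regular at q = 1. *)
Definition at_q (g : ratf C) : fps C :=
  xget 0 [set x | exists p d : {poly C}, [/\ d.[1] != 0, g = tof p / tof d &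
    x = peval p (fps_exp (2%:R)^-1) / peval d (fps_exp (2%:R)^-1)]].

(** f(z); the sum over r is finite at each order in h, f_(q,r) being divisible
    by (q - 1)^r. *)
Definition fz : ratfh C :=
  Fps (fun k => \sum_(r < k.+1)
    ratc (fcoef (at_q (phi r)) k) * (ratz C / (1 - ratz C)) ^+ r).
End Normalization.

Definition eh (a : C) : fps C := fps_exp a.
Definition half : C := (2%:R)^-1.
Definition kappa : fps C := eh half - eh (- half).

Definition Rc : mat2 N (fps C) := fun i j k l =>
  eh half * ((i == j) && (k == l) && (i == k))%:R
  + ((i == j) && (k == l) && (i != k))%:R
  + kappa * ((i < j)%N && (k == j) && (l == i))%:R.

Definition Pm (A : pzRingType) : mat2 N A := fun i j k l =>
  ((k == j) && (l == i))%:R.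

Definition Rh : mat2 N (ratfh C) := fun i j k l => emb (Rc i j k l).

Definition zh : ratfh C := fps_const (ratz C).

Definition Rbar : mat2 N (ratfh C) := fun i j k l =>
  Rh i j k l + emb kappa * zh / (1 - zh) * Pm _ i j k l.

Definition Rz (phi : nat -> ratf C) : mat2 N (ratfh C) := fun i j k l =>
  emb (eh (- half)) * (1 - zh) * fz phi / (1 - zh * emb (eh (-1)))
  * Rbar i j k l.

End RMatrix.

Section Reflection.
Variables (C : fieldType) (N : nat).
Local Notation term := (alg_term C ('I_N * 'I_N)).
Local Notation R := (@Rc C N).
Local Notation R21 := (flip R).
Local Notation "''l_' ( i , j )" := (AGen C (i, j)).

(** The entries of R L_1 R_21 L_2 = L_2 R L_1 R_21. *)
Inductive refl_rel (n : nat) : term -> term -> Prop :=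
  ReflRel (i j k l : 'I_N) : refl_rel n
    (\big[@AAdd _ _/ACst _ 0]_(a : 'I_N) \big[@AAdd _ _/ACst _ 0]_(a' : 'I_N)
     \big[@AAdd _ _/ACst _ 0]_(b : 'I_N) \big[@AAdd _ _/ACst _ 0]_(b' : 'I_N)
       AMul (ACst _ (R i a k b * R21 a' j b b')) (AMul 'l_(a, a') 'l_(b', l)))
    (\big[@AAdd _ _/ACst _ 0]_(a : 'I_N) \big[@AAdd _ _/ACst _ 0]_(a' : 'I_N)
     \big[@AAdd _ _/ACst _ 0]_(b : 'I_N) \big[@AAdd _ _/ACst _ 0]_(b' : 'I_N)
       AMul (ACst _ (R i a b b' * R21 a' j b' l)) (AMul 'l_(k, b) 'l_(a, a'))).

Definition OhMat := palg refl_rel.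
HB.instance Definition _ := GRing.PzRing.on OhMat.
HB.instance Definition _ := GRing.Lmodule.on OhMat.

Definition lgen (i j : 'I_N) : OhMat := pgen refl_rel (i, j).

Definition is_action (W : lmodType (fps C)) (act : OhMat -> W -> W) : Prop :=
  [/\ forall a, linear (act a),
      forall w, linear (act^~ w),
      forall w, act 1 w = w &
      forall a b w, act (a * b) w = act a (act b w)].

End Reflection.

Section Vacuum.
Variables (C : fieldType) (N : nat) (phi : nat -> ratf C).

(* The generator (i, j, a) stands for t_ij^(-a-1). *)
Local Notation X := ('I_N * 'I_N * nat)%type.
Local Notation term := (alg_term C X).
(* The coefficient of u^a in the entry (i,j) of T^+(u). *)
Definition tplus_term (i j : 'I_N) (a : nat) : term :=
  AAdd (ACst X ((i == j) && (a == 0%N))%:R)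
       (AMul (ACst X (- fps_X C)) (AGen C (i, j, a))).

(** The coefficient of u^p v^s in R(e^(u-v)), expanded in nonnegative powers
    of v. *)
Definition Ruv (i j k l : 'I_N) (p : int) (s : nat) : fps C :=
  exp_coefh (taylor 0 0 s (Rz phi i j k l)) p.

(* The coefficient of u^p v^s in the entry e_ij (x) e_kl of
     R(e^(u-v)) T_1(u) T_2(v) = T_2(v) T_1(u) R(e^(u-v)).
   The sums over the exponent a of u in T(u) are h-adically convergent; at
   level n they are cut at a bound B beyond which all terms vanish modulo
   h^n. *)
Inductive U_rel (n : nat) : term -> term -> Prop :=
  URel (i j k l : 'I_N) (p : int) (s B : nat) of
    (forall (a b : nat) (i' j' k' l' : 'I_N), (B <= a)%N -> (b <= s)%N ->
       exists r, Ruv i' j' k' l' (p - a%:Z) b = fps_mon 1 n * r) :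
  U_rel n
    (\big[@AAdd _ _/ACst _ 0]_(x : 'I_N) \big[@AAdd _ _/ACst _ 0]_(y : 'I_N)
     \big[@AAdd _ _/ACst _ 0]_(a < B) \big[@AAdd _ _/ACst _ 0]_(b < s.+1)
       AMul (ACst _ (Ruv i x k y (p - a%:Z) (s - b))) (AMul (tplus_term x j a) (tplus_term y l b)))
    (\big[@AAdd _ _/ACst _ 0]_(x : 'I_N) \big[@AAdd _ _/ACst _ 0]_(y : 'I_N)
     \big[@AAdd _ _/ACst _ 0]_(a < B) \big[@AAdd _ _/ACst _ 0]_(b < s.+1)
       AMul (ACst _ (Ruv x j y l (p - a%:Z) (s - b))) (AMul (tplus_term k y b) (tplus_term i x a))).

Definition Vac := palg U_rel.
HB.instance Definition _ := GRing.PzRing.on Vac.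
HB.instance Definition _ := GRing.Lmodule.on Vac.

(** t_ij^(-r), for r >= 1 *)
Definition tgen (i j : 'I_N) (r : nat) : Vac := pgen U_rel (i, j, r.-1).

(** The coefficient of u^a in t_ij^+(u). *)
Definition tplus (i j : 'I_N) (a : nat) : Vac :=
  ((i == j) && (a == 0%N))%:R - fps_X C *: tgen i j a.+1.

(** The product of the T^+_t(w_t), for [t] in [s], acting as the identity on
    the other tensor factors. *)
Definition Tplus k (s : seq 'I_k) : tser N k Vac := fun i j e =>
  if [forall t, (t \notin s) ==> (i t == j t) && (e t == 0%N)]
  then \prod_(t <- s) tplus (i t) (j t) (e t) else 0.

Local Notation V := Vac.
Local Notation K := (ratfh C).

(** Hom(V, V((z))_h) *)
Definition hom_laurent (A : int -> V -> V) : Prop :=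
  (forall k, linear (A k)) /\ (forall v, hlaurent (A^~ v)).

(** [Tm i j k] is the coefficient of u^k in the entry (i,j) of T^-(u).  The
    variable attached to the tensor factor 0 of R^01_1n is set to 0 in favour
    of z = e^u. *)
Definition is_Tminus (c : C) (Tm : 'I_N -> 'I_N -> int -> V -> V) : Prop :=
  (forall i j, hom_laurent (Tm i j)) /\
  forall n (i j : idx N (1 + n)%N) (e : expo (1 + n)%N) (d : int),
    e (lshift n ord0) = 0%N ->
    let act := [seq rshift 1 r | r <- enum 'I_n] in
    let Rp := prod12 1 n (expF (c / 2%:R)) (Rz phi) in
    let Rm := prod12 1 n (expF (- (c / 2%:R))) (Rz phi) in
    Tm (i (lshift n ord0)) (j (lshift n ord0)) d
       (\prod_(t <- act) tplus (i t) (j t) (e t)) =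
    tmul pred0 (fun (g : K) (F : K -> int -> V) => F g) (tinv pred0 Rp)
      (tmul pred0 (fun (v : V) (g : K) => fun g' d => exp_coefh (g' * g) d *: v)
         (Tplus act) Rm) i j e d.

(** Inverse in End C^N (x) Hom(V, V((u))_h). *)
Definition is_Tinverse (Tm Ti : 'I_N -> 'I_N -> int -> V -> V) : Prop :=
  (forall i j, hom_laurent (Ti i j)) /\
  forall i j v (k : int),
    let s := if (i == j) && (k == 0) then v else 0 in
    hsums (fun x : 'I_N * int => Tm i x.1 (k - x.2) (Ti x.1 j x.2 v)) s /\
    hsums (fun x : 'I_N * int => Ti i x.1 (k - x.2) (Tm x.1 j x.2 v)) s.

Definition zbinom (k : int) (p : nat) : C :=
  (\prod_(i < p) (k%:~R - i%:R)) / (p`!)%:R.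

(** The coefficient of u^e z^k in A(z + u + a h). *)
Definition op_shift (A : int -> V -> V) (a : C) (e : nat) (k : int) (v : V) : V :=
  hsum (fun p : nat =>
    fps_mon (zbinom (k + p%:Z) p * 'C(p, e)%:R * a ^+ (p - e)) (p - e)
      *: A (k + p%:Z) v).

(** Action of an operator series on a V-valued series in the same variable. *)
Definition op_app (A : int -> V -> V) (x : int -> V) : int -> V :=
  fun k => hsum (fun d : int => A (k - d) (x d)).

Definition tplus_op (i j : 'I_N) (k : int) (v : V) : V :=
  if k is Posz a then tplus i j a * v else 0.

(** T^+_[n](z|u) *)
Definition Tp_op n : tser N n ((int -> V) -> int -> V) := fun i j e =>
  foldr (fun r F x => op_app (op_shift (tplus_op (i r) (j r)) 0 (e r)) (F x)) id
    (enum 'I_n).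

(** T^-_[n](z + hc/2|u)^(-1), i.e.
    T^-_n(z + u_n + hc/2)^(-1) ... T^-_1(z + u_1 + hc/2)^(-1), for [Ti] the
    series T^-(z)^(-1). *)
Definition Tm_inv_op (c : C) (Ti : 'I_N -> 'I_N -> int -> V -> V) n :
    tser N n ((int -> V) -> int -> V) := fun i j e =>
  foldr (fun r F x => op_app (op_shift (Ti (i r) (j r)) (c / 2%:R) (e r)) (F x)) id
    (rev (enum 'I_n)).

(** [Y v k] is the coefficient of z^k in Y(v, z). *)
Definition is_vertex_map (c : C) (Ti : 'I_N -> 'I_N -> int -> V -> V)
    (Y : V -> int -> V -> V) : Prop :=
  [/\ forall v, hom_laurent (Y v),
      forall k w, linear (fun v => Y v k w) &
      forall n (i j : idx N n) (e : expo n) (k : int) (w : V),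
        Y (Tplus (enum 'I_n) i j e) k w =
        tmul pred0 (fun F G x => F (G x)) (@Tp_op n) (@Tm_inv_op c Ti n) i j e
          (fun d => if d == 0 then w else 0) k].

Section Maps.
Variables n m : nat.
Local Notation T13 := (Tplus [seq lshift m r | r <- enum 'I_n]).
Local Notation T24 := (Tplus [seq rshift n s | s <- enum 'I_m]).

(** T^+13_[n](u) T^+24_[m](v) (1 (x) 1), with [s] applied to it. *)
Definition TT (D : zmodType) (s : V -> V -> D) : tser N (n + m) D :=
  tmul pred0 s T13 T24.

(** T^+13_[n](u) B T^+24_[m](v) (1 (x) 1) *)
Definition TBT (B : tser N (n + m) K) : tser N (n + m) (ten2 V) :=
  tmul pred0 (fun (u : V) (F : V -> ten2 V) => F u) T13
    (tmul pred0 (fun (g : K) (v : V) => fun u => g *: pure u v) B T24).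

Definition lmulT o (X : tser N (n + m) K) (Y : tser N (n + m) (ten2 V)) :=
  tmul o (fun g x => g *: x) X Y.
Definition rmulT (Y : tser N (n + m) (ten2 V)) (X : tser N (n + m) K) :=
  tmul pred0 (fun x g => g *: x) Y X.

Local Notation R12 := (prod12 n m (@constF N K) (@Rh C N)).
Local Notation R21 := (prod21 n m (@constF N K) (@Rh C N)).
Local Notation R12z a := (prod12 n m (expF a) (Rz phi)).
Local Notation R21z a := (prod21 n m (expF a) (Rz phi)).

Definition sigma_rhs : tser N (n + m) (ten2 V) :=
  lmulT (@LR n m) (tinv (@RL n m) R12)
    (rmulT (lmulT pred0 (R12z 0) (TBT R21)) (tinv pred0 (R21z 0))).

Definition rho_rhs (c : C) : tser N (n + m) (ten2 V) :=
  lmulT (@RL n m) (tinv (@RL n m) R21)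
    (rmulT (rmulT (TBT (tinv pred0 (R12z c))) (R12z 0)) R21).
End Maps.

Arguments TT n m {D} s.
Arguments sigma_rhs n m : clear implicits.
Arguments rho_rhs n m c : clear implicits.

Definition is_sigma (sigma : V -> V -> ten2 V) : Prop :=
  ten_map sigma /\ forall n m, TT n m sigma = sigma_rhs n m.

Definition is_rho (c : C) (rho : V -> V -> ten2 V) : Prop :=
  ten_map rho /\ forall n m, TT n m rho = rho_rhs n m c.

(** [Yrho Y rho u v k] is the coefficient of z^k in Y^rho(u,z)v. *)
Definition Yrho (Y : V -> int -> V -> V) (rho : V -> V -> ten2 V)
    (u v : V) (k : int) : V :=
  ten_lift (fun a b g => hsum (fun d : int => exp_coefh g d *: Y a (k - d) b))
    (rho u v).

Section Module.
Variables (W0 : lmodType C).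
Local Notation W := (fps W0).
Variables (Y : V -> int -> V -> V) (sigma rho : V -> V -> ten2 V).
(* [YW v k] is the coefficient of z^k in Y_W(v,z). *)
Variable YW : V -> int -> W -> W.

(** The coefficient of z1^a z2^b in (z1 - z2)^r F(z1,z2). *)
Definition zdiff (r : nat) (F : int -> int -> W) (a b : int) : W :=
  \sum_(i < r.+1)
    fps_const ((-1) ^+ i * 'C(r, i)%:R : C) *: F (a - (r - i)%N%:Z) (b - i%:Z).

(** Y_W(u,z1) Y_W(v,z2) w *)
Definition YYW (u v : V) (w : W) (a b : int) : W := YW u a (YW v b w).

(** Y_W(z1)(1 (x) Y_W(z2)) applied to the expansion of sigma(z1/z2)(u (x) v) (x) w
    in C((z1))((z2)). *)
Definition YYsigma (u v : V) (w : W) (a b : int) : W :=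
  ten_lift (fun x y g =>
    hsum (fun d : int => inf_coefh g d *: YYW x y w (a + d) (b - d))) (sigma u v).

(** The coefficient of z0^p in e^(a z0). *)
Definition exp_pow (a p : int) : C :=
  if p is Posz k then a%:~R ^+ k / (k`!)%:R else 0.

(** The coefficient of z0^p z2^b in z2^r (e^z0 - 1)^r Y_W(Y^rho(u,z0)v,z2) w. *)
Definition YWrho (r : nat) (u v : V) (w : W) (p b : int) : W :=
  hsum (fun d : nat => fps_const (fcoef ((fps_exp (1 : C) - 1) ^+ r) d) *:
    YW (Yrho Y rho u v (p - d%:Z)) (b - r%:Z) w).

Definition weak_associativity : Prop :=
  forall (u v : V) (n : nat), (0 < n)%N -> exists r : nat,
    (forall w : W, exists B : int, forall a b : int, (a < B) || (b < B) ->
       hdvd n (zdiff r (YYW u v w) a b)) /\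
    (forall (w : W) (p b : int),
       hsums_mod n
         (fun a : int => fps_const (exp_pow a p) *: zdiff r (YYW u v w) a (b - a))
         (YWrho r u v w p b)).

Definition locality : Prop :=
  forall (u v : V) (n : nat), (0 < n)%N -> exists r : nat,
    forall (w : W) (a b : int),
      hdvd n (zdiff r (YYsigma u v w) a b -
              zdiff r (fun a' b' => YYW v u w b' a') a b).

Definition weak_module : Prop :=
  [/\ (forall v k, linear (YW v k)) /\ (forall k w, linear (fun v => YW v k w)),
      forall v w, hlaurent (fun k => YW v k w),
      forall k w, YW 1 k w = if k == 0 then w else 0,
      weak_associativity &
      locality].

End Module.

End Vacuum.

Arguments TT {C N phi} n m {D} s.
Arguments TBT {C N phi} n m B.
Arguments sigma_rhs {C N} phi n m.
Arguments rho_rhs {C N} phi n m c.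

(* Main.v *)
(* Take u = v = 0 in the formula for sigma with n = m = 1 and clear the inverses:
   the normalizing factor of R(z) is a unit and cancels, which leaves
     (1 - z) Rbar(z) T_1 R_21 T_2  =  L_2 R L_1 (1 - z) Rbar_21(z),
   where L_2 R L_1 stands for sigma applied to T_1, T_2.  This is linear in z, so no
   expansion of a rational function enters.  Applying Y_W and sigma-locality
   turns it, modulo h^n and after multiplication by a power of z_1 - z_2, into a
   relation between the series Y_W(T^+(0)1, z) = 1 - h Y_W(t^(-1)1, z).  By the
   hypothesis on the poles its lowest coefficient with respect to z_1, in total
   degree -2 before the multiplication, is h^2 times the reflection equation for
   the residues.  As n is arbitrary and W is h-adically separated and torsion free,
   the reflection equation holds. *)
From HB Require Import structures.
Require Import Defs.
From mathcomp Require Import all_boot all_order all_algebra.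
From mathcomp Require Import reals.
From mathcomp Require Import complex zify ring.
From mathcomp Require Import generic_quotient fraction boolp classical_sets functions.

Set Implicit Arguments.
Unset Strict Implicit.
Unset Printing Implicit Defensive.

Import GRing.Theory.
Local Open Scope ring_scope.

(** * Formal power series *)

(** [ten_lift], through which Y_W is applied to sigma, is a choice among values approximated by
    finite sums, so algebraic identities do not pass through it directly. An additive map [ten_lim]
    is therefore built from representatives of the limit, and the two are compared on finite sums of
    pure tensors; the values of sigma on the entries of T^+(0)1 are such sums. As W is not a module
    over C(z)[[h]], multiplication by z = z_1/z_2 becomes the shift (a, b) -> (a - 1, b + 1) of
    exponents.

    The spectral parameter disappears because, at z_1^(-1) z_2^(-1), every term with a factor z
    reads a coefficient of z_1^(-2), which vanishes, while the summand 1 of 1 - h Y_W(t^(-1)1, z)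
    lives in degree 0 only. The factor (z_1 - z_2)^r loses nothing: at z_1^(-1) z_2^(r-1) only
    (-z_2)^r contributes, since the other terms need lower powers of z_1. The exponent r varies with
    n, but up to sign the coefficient obtained does not, so the congruences for all n concern one
    element of W. *)

Section FpsUnits.
Variable A : comNzRingType.
Implicit Types f g : fps A.

Lemma fcoefD (W : zmodType) (x y : fps W) k :
  fcoef (x + y) k = fcoef x k + fcoef y k.
Proof. by []. Qed.

Lemma fcoefN (W : zmodType) (x : fps W) k : fcoef (- x) k = - fcoef x k.
Proof. by []. Qed.

Lemma fcoef1 k : fcoef (1 : fps A) k = (k == 0%N)%:R.
Proof. by rewrite /=; case: eqP. Qed.

Lemma fcoef_sum (W : zmodType) (I : Type) (r : seq I) (P : pred I)
    (F : I -> fps W) k :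
  fcoef (\sum_(i <- r | P i) F i) k = \sum_(i <- r | P i) fcoef (F i) k.
Proof. exact: (big_morph (fun x : fps W => fcoef x k)). Qed.

Lemma fcoefM f g k :
  fcoef (f * g) k = \sum_(i < k.+1) fcoef f i * fcoef g (k - i).
Proof. by []. Qed.

Lemma fcoefZ (W : lmodType A) f (w : fps W) k :
  fcoef (f *: w) k = \sum_(i < k.+1) fcoef f i *: fcoef w (k - i).
Proof. by []. Qed.

Lemma fcoef_monZ (W : lmodType A) a n (w : fps W) k :
  fcoef (fps_mon a n *: w) k = if (n <= k)%N then a *: fcoef w (k - n) else 0.
Proof.
rewrite fcoefZ; case: leqP => nk.
  rewrite (bigD1 (Ordinal (nk : (n < k.+1)%N))) //= eqxx big1 ?addr0 // => i.
  by rewrite -val_eqE /= => /negPf ->; rewrite scale0r.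
rewrite big1 // => i _ /=; case: eqP => [e|_]; last by rewrite scale0r.
by have := ltn_ord i; rewrite e ltnS leqNgt nk.
Qed.

Lemma fcoef_monM a n f k :
  fcoef (fps_mon a n * f) k = if (n <= k)%N then a * fcoef f (k - n) else 0.
Proof. exact: (@fcoef_monZ A^o a n f k). Qed.

Lemma fps_monM a b m n : fps_mon a m * fps_mon b n = fps_mon (a * b) (m + n) :> fps A.
Proof.
apply/fpsP => k; rewrite fcoef_monM /=; case: leqP => [mk|km].
  rewrite -(eqn_add2l m) subnKC //; case: eqP => // _; exact: mulr0.
by case: eqP => // e; move: km; rewrite e -ltn_subRL subnn.
Qed.

Definition fps_cst f : A := fcoef f 0.

Fact fps_cst_is_zmod_morphism : zmod_morphism fps_cst.
Proof. by []. Qed.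
Fact fps_cst_is_monoid_morphism : monoid_morphism fps_cst.
Proof. by split=> // f g; rewrite /fps_cst fcoefM big_ord1. Qed.

HB.instance Definition _ :=
  GRing.isZmodMorphism.Build (fps A) A fps_cst fps_cst_is_zmod_morphism.
HB.instance Definition _ :=
  GRing.isMonoidMorphism.Build (fps A) A fps_cst fps_cst_is_monoid_morphism.

Lemma fps_unitP f : reflect (exists g, g * f = 1) (f \is a GRing.unit).
Proof. exact: asboolP. Qed.

(* The coefficients of the inverse are built by strong recursion: the list
   [inv_coefs f b n] holds the first [n] of them, most recent first. *)
Fixpoint inv_coefs f (b : A) n : seq A :=
  if n is k.+1 then
    let s := inv_coefs f b k in
    b * ((k == 0%N)%:R - \sum_(i < k) fcoef f i.+1 * s`_i) :: s
  else [::].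

Lemma inv_coefsE f b n i : (i < n)%N ->
  (inv_coefs f b n)`_i = (inv_coefs f b (n - i))`_0.
Proof.
elim: n i => // n IH [|i] // lin; rewrite subSS -IH //.
Qed.

(** The coefficients may form any commutative ring, because determinants over iterated series rings
    have to be inverted later. *)
Lemma fps_unit_cst f (b : A) : fcoef f 0 * b = 1 -> f \is a GRing.unit.
Proof.
move=> fb; pose g : fps A := Fps (fun n => (inv_coefs f b n.+1)`_0).
apply/fps_unitP; exists g; rewrite mulrC; apply/fpsP => k.
rewrite fcoefM big_ord_recl subn0 [fcoef g k]/= mulrA fb mul1r fcoef1.
rewrite [X in _ + X](eq_bigr (fun i : 'I_k => fcoef f i.+1 * (inv_coefs f b k)`_i)) ?subrK //.
by move=> i _; rewrite lift0 inv_coefsE ?ltn_ord // -(subnSK (ltn_ord i)).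
Qed.

End FpsUnits.

Section FpsField.
Variable F : fieldType.
Implicit Types f g : fps F.

Lemma fps_field_unit f : fcoef f 0 != 0 -> f \is a GRing.unit.
Proof. by move=> f0; apply: (@fps_unit_cst _ _ (fcoef f 0)^-1); apply: mulfV. Qed.

(** The valuation v is the least index of a nonzero coefficient. This gives both the pole order of a
    quotient of series and cancellation. *)
Lemma fps_split f : f != 0 ->
  exists v u, f = fps_mon 1 v * u /\ u \is a GRing.unit.
Proof.
move=> f0; have exk : exists k, fcoef f k != 0.
  apply: contrapT => nex; case/eqP: f0; apply/fpsP => k.
  by apply/eqP/negPn/negP => fk; apply: nex; exists k.
case: (ex_minnP exk) => v fv vmin.
exists v, (Fps (fun k => fcoef f (k + v))); split.
  apply/fpsP => k; rewrite fcoef_monM /=; case: leqP => kv.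
    by rewrite mul1r subnK.
  apply/eqP/negPn/negP => /vmin; by rewrite leqNgt kv.
by apply: fps_field_unit; rewrite /= add0n.
Qed.

Lemma fps_mulfI f : f != 0 -> injective ( *%R f).
Proof.
case/fps_split=> v [u [-> uu]] x y; rewrite -!mulrA => /fpsP e.
apply: (mulrI uu); apply/fpsP => k; have := e (k + v)%N.
by rewrite !fcoef_monM leq_addl addnK !mul1r.
Qed.

End FpsField.

(** * Divisibility by powers of h and summable families *)

Section Hadic.
Variables (C : fieldType) (W0 : lmodType C).
Local Notation W := (fps W0).
Implicit Types x y : W.

Lemma hdvdP n x : hdvd n x <-> forall k, (k < n)%N -> fcoef x k = 0.
Proof.
split=> [[y ->] k kn|x0]; first by rewrite fcoef_monZ leqNgt kn.
exists (Fps (fun k => fcoef x (k + n))); apply/fpsP => k.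
rewrite fcoef_monZ; case: leqP => [nk|/x0 //]; by rewrite scale1r /= subnK.
Qed.

End Hadic.

Section HadicModule.
Variables (A : comNzRingType) (M : lmodType (fps A)).
Implicit Types x y : M.

Lemma hdvd0 n : hdvd n (0 : M).
Proof. by exists 0; rewrite scaler0. Qed.
Lemma hdvdD n x y : hdvd n x -> hdvd n y -> hdvd n (x + y).
Proof. by move=> [a ->] [b ->]; exists (a + b); rewrite scalerDr. Qed.
Lemma hdvdZ n a x : hdvd n x -> hdvd n (a *: x).
Proof. by move=> [b ->]; exists (a *: b); rewrite !scalerA mulrC. Qed.
Lemma hdvdN n x : hdvd n x -> hdvd n (- x).
Proof. by rewrite -scaleN1r; apply: hdvdZ. Qed.
Lemma hdvdB n x y : hdvd n x -> hdvd n y -> hdvd n (x - y).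
Proof. by move=> hx hy; apply: hdvdD => //; apply: hdvdN. Qed.
Lemma hdvd_sum n (I : Type) (r : seq I) (P : pred I) (F : I -> M) :
  (forall i, P i -> hdvd n (F i)) -> hdvd n (\sum_(i <- r | P i) F i).
Proof. by move=> hF; apply: big_ind => //; [exact: hdvd0 | exact: hdvdD]. Qed.
Lemma hdvd_trans n x y z : hdvd n (x - y) -> hdvd n (y - z) -> hdvd n (x - z).
Proof. by move=> h1 h2; have := hdvdD h1 h2; rewrite addrA subrK. Qed.
Lemma hdvd_sym n x y : hdvd n (x - y) -> hdvd n (y - x).
Proof. by move/hdvdN; rewrite opprB. Qed.
Lemma hdvd_mon n x : hdvd n (fps_mon 1 n *: x).
Proof. by exists x. Qed.
End HadicModule.

Section Summation.
Variables (C : fieldType) (W0 : lmodType C).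
Local Notation W := (fps W0).
Implicit Types x y : W.

Lemma hdvd_eq0 x : (forall n, hdvd n x) -> x = 0.
Proof. by move=> hx; apply/fpsP => k; have /hdvdP/(_ k) -> := hx k.+1. Qed.

Lemma hdvd_eq x y : (forall n, hdvd n (x - y)) -> x = y.
Proof. by move=> hx; apply/eqP; rewrite -subr_eq0; apply/eqP/hdvd_eq0. Qed.

Variable I : eqType.
Implicit Types f g : I -> W.

Definition summable f := forall n, exists J : seq I,
  forall i, i \notin J -> hdvd n (f i).

Lemma sum_outside n f (J J' : seq I) : uniq J -> uniq J' -> {subset J <= J'} ->
  (forall i, i \notin J -> hdvd n (f i)) ->
  hdvd n (\sum_(i <- J') f i - \sum_(i <- J) f i).
Proof.
move=> uJ uJ' sJ hJ.
have e : \sum_(i <- J) f i = \sum_(i <- J' | i \in J) f i.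
  rewrite -[RHS]big_filter; apply: perm_big; apply: uniq_perm => //.
    exact: filter_uniq.
  move=> i; rewrite mem_filter; case: (boolP (i \in J)) => // /sJ ->.
  by [].
rewrite e [X in X - _](bigID (fun i => i \in J)) /= [X in X - _]addrC addrK.
by apply: hdvd_sum => i; apply: hJ.
Qed.

(** Completeness of W_0[[h]]: the k-th coefficient of the sum is already that of the finite sum
    which is exact modulo h^(k+1). *)
Lemma summable_hsums f : summable f -> exists s, hsums f s.
Proof.
move=> sf; pose J n := undup (sval (cid (sf n))).
have hJ n i : i \notin J n -> hdvd n (f i).
  by rewrite mem_undup => /(svalP (cid (sf n))).
have uJ n : uniq (J n) by exact: undup_uniq.
exists (Fps (fun k => fcoef (\sum_(i <- J k.+1) f i) k)) => n.
exists (J n) => J' uJ' sJ; apply/hdvdP => k kn; rewrite fcoefD fcoefN /=.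
have hk i : i \notin J n -> hdvd k.+1 (f i).
  move=> /hJ /hdvdP hi; apply/hdvdP => l lk; apply: hi.
  exact: leq_trans lk kn.
(* Neither index set need contain the other, so both finite sums are compared with the one over
   their union. *)
pose U := undup (J' ++ J k.+1).
have memU i : (i \in U) = (i \in J') || (i \in J k.+1).
  by rewrite mem_undup mem_cat.
have uU : uniq U by exact: undup_uniq.
have h1 : hdvd k.+1 (\sum_(i <- U) f i - \sum_(i <- J k.+1) f i).
  apply: (sum_outside (uJ _) uU _ (@hJ _)) => i.
  by rewrite memU orbC => ->.
have h2 : hdvd k.+1 (\sum_(i <- U) f i - \sum_(i <- J') f i).
  apply: (sum_outside uJ' uU) => i; first by rewrite memU => ->.
  by move=> iJ; apply: hk; apply: contra iJ; apply: sJ.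
have /hdvdP/(_ k) := hdvdB h2 h1.
by rewrite opprB addrC addrA subrK => /(_ (leqnn _)).
Qed.

Lemma hsums_uniq f s t : hsums f s -> hsums f t -> s = t.
Proof.
move=> hs ht; apply: hdvd_eq => n.
case: (hs n) => J hJ; case: (ht n) => K hK.
pose U := undup (J ++ K).
have h1 := hJ U (undup_uniq _) _; have h2 := hK U (undup_uniq _) _.
have := hdvdB (h1 _) (h2 _); rewrite opprB addrA subrK; apply.
  by move=> i iJ; rewrite mem_undup mem_cat iJ.
by move=> i iJ; rewrite mem_undup mem_cat iJ orbT.
Qed.

Lemma hsumE f s : hsums f s -> hsum f = s.
Proof.
move=> hs; rewrite /hsum; case: xgetP => [t _ /= ht|/(_ s)//].
exact: hsums_uniq ht hs.
Qed.

Lemma hsumP f : summable f -> hsums f (hsum f).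
Proof. by case/summable_hsums => s hs; rewrite (hsumE hs). Qed.

Lemma hsumsD f g s t : hsums f s -> hsums g t ->
  hsums (fun i => f i + g i) (s + t).
Proof.
move=> hs ht n; case: (hs n) => J hJ; case: (ht n) => K hK.
exists (J ++ K) => J' uJ' sJ.
have sJ1 : {subset J <= J'} by move=> i iJ; apply: sJ; rewrite mem_cat iJ.
have sJ2 : {subset K <= J'} by move=> i iK; apply: sJ; rewrite mem_cat iK orbT.
by rewrite big_split /= opprD addrACA; apply: hdvdD; [apply: hJ | apply: hK].
Qed.

Lemma hsumsZ (a : fps C) f s : hsums f s -> hsums (fun i => a *: f i) (a *: s).
Proof.
move=> hs n; case: (hs n) => J hJ; exists J => J' uJ' sJ.
by rewrite -scaler_sumr -scalerBr; apply: hdvdZ; apply: hJ.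
Qed.

Lemma hsum_single f i0 : (forall i, i != i0 -> f i = 0) -> hsum f = f i0.
Proof.
move=> f0; apply: hsumE => n; exists [:: i0] => J' uJ' sJ.
rewrite (bigD1_seq i0) ?sJ ?mem_head //= big1 ?addr0 ?subrr //; exact: hdvd0.
Qed.

Lemma hsum_reindex (p q : I -> I) f : cancel p q -> cancel q p -> summable f ->
  hsum (f \o p) = hsum f.
Proof.
move=> pK qK /hsumP sf; apply: hsumE => n; case: (sf n) => J hJ.
exists (map q J) => J' uJ' sJ.
have := hJ (map p J'); rewrite big_map; apply.
  by rewrite map_inj_uniq //; apply: can_inj pK.
by move=> i iJ; rewrite -(qK i); apply/map_f/sJ/map_f.
Qed.

End Summation.

(** * Expansion of rational functions at infinity *)

Section ExpansionAtInfinity.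
Variable C : fieldType.
Local Notation prev := (@Defs.prev C).
Local Notation ratz := Defs.ratz.
Implicit Types (p d : {poly C}) (g : ratf C) (a : int -> C) (F : fps C).

Lemma prevD m p d : prev m (p + d) = prev m p + prev m d.
Proof. by apply/fpsP => k /=; case: ifP; rewrite ?addr0 ?coefD. Qed.

Lemma prevZ m c p : prev m (c *: p) = fps_const c * prev m p.
Proof.
by apply/fpsP => k; rewrite fcoef_monM /= subn0; case: ifP; rewrite ?mulr0 ?coefZ.
Qed.

Lemma prev0 m : prev m 0 = 0 :> fps C.
Proof. by apply/fpsP => k /=; case: ifP; rewrite ?coef0. Qed.

Lemma prev_sum m (I : Type) (r : seq I) (G : I -> {poly C}) :
  prev m (\sum_(i <- r) G i) = \sum_(i <- r) prev m (G i).
Proof.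
elim: r => [|i r IH]; first by rewrite !big_nil prev0.
by rewrite !big_cons prevD IH.
Qed.

Lemma prevXn m k : (k <= m)%N -> prev m 'X^k = fps_mon 1 (m - k) :> fps C.
Proof.
move=> km; apply/fpsP => i /=; rewrite coefXn.
case: leqP => im; last first.
  by case: eqP => // e; move: im; rewrite e ltnNge leq_subr.
suff -> : ((m - i)%N == k) = (i == m - k)%N by case: eqP.
apply/eqP/eqP => [<-|->]; by rewrite subKn.
Qed.

Lemma poly_monE m p : (size p <= m.+1)%N -> p = \sum_(i < m.+1) p`_i *: 'X^i.
Proof.
move=> sp; rewrite -poly_def; apply/polyP => i; rewrite coef_poly.
by case: ltnP => // mi; rewrite nth_default // (leq_trans sp).
Qed.

Lemma prevM m m' p d : (size p <= m.+1)%N -> (size d <= m'.+1)%N ->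
  prev (m + m') (p * d) = prev m p * prev m' d.
Proof.
move=> sp sd; rewrite (poly_monE sp) (poly_monE sd) mulr_suml !prev_sum mulr_suml.
apply: eq_bigr => i _; rewrite !mulr_sumr !prev_sum; apply: eq_bigr => j _.
have im : (i <= m)%N by rewrite -ltnS.
have jm : (j <= m')%N by rewrite -ltnS.
rewrite -scalerAl -scalerAr -exprD !prevZ !prevXn // ?leq_add //.
have -> : fps_mon 1 (m + m' - (i + j)) = fps_mon 1 (m - i) * fps_mon 1 (m' - j) :> fps C.
  by rewrite fps_monM mulr1; congr fps_mon; lia.
by ring.
Qed.

Lemma prev_neq0 m d : d != 0 -> (size d <= m.+1)%N -> prev m d != 0.
Proof.
move=> d0 sd; apply: contraNneq d0 => /fpsP pd; apply/eqP/polyP => i.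
rewrite coef0; have [im|mi] := leqP i m; last by rewrite nth_default // (leq_trans sd).
by have := pd (m - i)%N; rewrite /= leq_subr subKn.
Qed.

(** The Laurent series y^(-e) F with y = 1/x, in a form convertible with the function that
    [laurent_quot] prescribes. *)
Definition lau (e : nat) F (k : int) : C :=
  if k + e%:Z is Posz n then fcoef F n else 0.

Lemma lau_mon e e' F : lau (e + e') (fps_mon 1 e' * F) = lau e F.
Proof.
apply: funext => k; rewrite /lau PoszD addrA.
case: (k + e%:Z) => n.
  by rewrite -PoszD fcoef_monM leq_addl addnK mul1r.
case E : (Negz n + e'%:Z) => [l|//]; rewrite fcoef_monM leqNgt.
by rewrite (_ : l < e')%N //; move: E; rewrite NegzE; lia.
Qed.

Lemma lauD e F F' k : lau e (F + F') k = lau e F k + lau e F' k.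
Proof. by rewrite /lau; case: (k + e%:Z) => n; rewrite ?addr0. Qed.

Lemma lauZ e c F k : lau e (fps_const c * F) k = c * lau e F k.
Proof.
by rewrite /lau; case: (k + e%:Z) => n; rewrite ?mulr0 // fcoef_monM /= subn0.
Qed.

Lemma lauS e F k : lau e.+1 F k = lau e F (k + 1).
Proof. by rewrite /lau -addn1 PoszD [e%:Z + _]addrC addrA. Qed.

(** The property by which [inf_coef] is chosen. *)
Definition expands g a := exists p d m,
  [/\ d != 0, g = tof p / tof d, (size p <= m.+1)%N, (size d <= m.+1)%N &
      laurent_quot (prev m p) (prev m d) a].

Lemma tofD p d : tof (p + d) = tof p + tof d. Proof. exact: rmorphD. Qed.
Lemma tofM p d : tof (p * d) = tof p * tof d. Proof. exact: rmorphM. Qed.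
Lemma tof1 : tof 1 = 1 :> ratf C. Proof. exact: rmorph1. Qed.
Lemma tof_eq0 p : (tof p == 0) = (p == 0). Proof. exact: tofrac_eq0. Qed.
Lemma tof_inj : injective (@tof C).
Proof.
by move=> p d /eqP; rewrite -subr_eq0 -rmorphB tof_eq0 subr_eq0 => /eqP.
Qed.

Lemma ratfP g : exists p d, d != 0 /\ g = tof p / tof d.
Proof.
exists (\n_(repr g)), (\d_(repr g)); split; first exact: denom_ratioP.
have d0 := denom_ratioP (repr g).
apply: (canRL (mulfK _)); first by rewrite tof_eq0.
rewrite -{1}[g]reprK /tof; rewrite !piE; apply/eqmodP => /=.
rewrite FracField.equivfE /FracField.mulf !numden_Ratio ?oner_eq0 ?mulr1 ?mulf_neq0 //.
by rewrite mulrC.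
Qed.

Lemma laurent_quot_ex (num den : fps C) : den != 0 -> exists a, laurent_quot num den a.
Proof.
(* With the denominator y^v u, the quotient is y^(-v) times the series u^(-1) num. *)
move=> d0; case: (fps_split d0) => v [u [e uu]].
exists (lau v (u^-1 * num)); split=> //; exists v, (u^-1 * num); split=> //.
by rewrite e mulrA mulrK.
Qed.

Lemma expands_ex g : exists a, expands g a.
Proof.
case: (ratfP g) => p [d [d0 e]].
pose m := maxn (size p) (size d).
have sp : (size p <= m.+1)%N by rewrite leqW // leq_maxl.
have sd : (size d <= m.+1)%N by rewrite leqW // leq_maxr.
case: (laurent_quot_ex (prev m p) (prev_neq0 d0 sd)) => a ha.
by exists a, p, d, m.
Qed.

(** The fraction, the degree bound m and the shift e are all arbitrary. Cross-multiplying p d' = p'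
    d survives reversal because [prev] is multiplicative when the bounds add; cancelling the two
    reversed denominators leaves y^e' F = y^e F'. *)
Lemma expands_uniq g a a' : expands g a -> expands g a' -> a = a'.
Proof.
move=> [p [d [m [d0 -> sp sd]]]] [D0 [e [F [FE ->]]]].
move=> [p' [d' [m' [d0' gE sp' sd']]]] [D0' [e' [F' [FE' ->]]]].
have E : p * d' = p' * d.
  apply: tof_inj; rewrite !tofM; apply/eqP; rewrite -eqr_div ?tof_eq0 //.
  exact/eqP.
have EE : prev m p * prev m' d' = prev m' p' * prev m d.
  by rewrite -!prevM // E addnC.
have FF : fps_mon 1 e' * F = fps_mon 1 e * F'.
  apply: (fps_mulfI D0); apply: (fps_mulfI D0').
  transitivity (fps_mon 1 e' * prev m' d' * (prev m d * F)); first by ring.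
  transitivity (fps_mon 1 e * prev m d * (prev m' d' * F')); last by ring.
  rewrite FE FE'.
  transitivity (fps_mon 1 e * fps_mon 1 e' * (prev m p * prev m' d')); first by ring.
  by rewrite EE; ring.
rewrite -[LHS]/(lau e F) -[RHS]/(lau e' F').
by rewrite -(lau_mon e e') FF addnC lau_mon.
Qed.

Lemma inf_coefP g : expands g (inf_coef g).
Proof.
rewrite /inf_coef; case: xgetP => [a _ //|/= na].
by case: (expands_ex g) => a ha; case: (na a).
Qed.

Lemma inf_coefE g a : expands g a -> inf_coef g = a.
Proof. exact: expands_uniq (inf_coefP g). Qed.

Lemma inf_coefD g g' k : inf_coef (g + g') k = inf_coef g k + inf_coef g' k.
Proof.
have [p [d [m [d0 gE sp sd]]]] := inf_coefP g.
move=> [D0 [e [F [FE aE]]]].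
have [p' [d' [m' [d0' gE' sp' sd']]]] := inf_coefP g'.
move=> [D0' [e' [F' [FE' aE']]]].
rewrite (@inf_coefE (g + g') (lau (e + e') (fps_mon 1 e' * F + fps_mon 1 e * F'))).
  by rewrite lauD aE aE' lau_mon addnC lau_mon.
have sM (q r : {poly C}) l l' : (size q <= l.+1)%N -> (size r <= l'.+1)%N ->
    (size (q * r)%R <= (l + l').+1)%N.
  move=> sq sr; apply: leq_trans (size_polyMleq _ _) _.
  by rewrite -subn1 leq_subLR add1n -addSn -addnS leq_add.
exists (p * d' + p' * d), (d * d'), (m + m')%N; split.
- exact: mulf_neq0.
- by rewrite gE gE' tofD !tofM addf_div ?tof_eq0.
- apply: leq_trans (size_polyD _ _) _; rewrite geq_max sM //=.
  by rewrite addnC sM.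
- exact: sM.
split; first by apply: prev_neq0; [exact: mulf_neq0 | exact: sM].
exists (e + e')%N, (fps_mon 1 e' * F + fps_mon 1 e * F'); split=> //.
have -> : prev (m + m') (p * d' + p' * d) =
    prev m p * prev m' d' + prev m' p' * prev m d.
  by rewrite prevD prevM // addnC prevM.
have XD i l : fps_mon 1 (i + l) = fps_mon 1 i * fps_mon 1 l :> fps C.
  by rewrite fps_monM mulr1.
rewrite prevM // XD.
transitivity (fps_mon 1 e' * prev m' d' * (prev m d * F) +
              fps_mon 1 e * prev m d * (prev m' d' * F')); first by ring.
by rewrite FE FE'; ring.
Qed.

Lemma inf_coefZ c g k : inf_coef (ratc c * g) k = c * inf_coef g k.
Proof.
have [p [d [m [d0 gE sp sd]]]] := inf_coefP g.
move=> [D0 [e [F [FE aE]]]].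
rewrite (@inf_coefE (ratc c * g) (lau e (fps_const c * F))) ?lauZ ?aE //.
exists (c *: p), d, m; split=> //; first by rewrite gE -mul_polyC tofM mulrA.
  exact: leq_trans (size_scale_leq _ _) sp.
split=> //; exists e, (fps_const c * F); split=> //.
by rewrite prevZ [LHS]mulrCA FE mulrCA.
Qed.

(** Raising the bound to m + 1 makes room for 'X * p. Its reversal is then that of p, while the
    reversed denominator gains a factor y, so the quotient is multiplied by 1/y. *)
Lemma inf_coef_ratz g k : inf_coef (ratz C * g) k = inf_coef g (k + 1).
Proof.
have [p [d [m [d0 gE sp sd]]]] := inf_coefP g.
move=> [D0 [e [F [FE aE]]]].
rewrite (@inf_coefE (ratz C * g) (lau e.+1 F)) ?lauS ?aE //.
have -> : ratz C * g = tof ('X * p) / tof d by rewrite gE tofM mulrA.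
exists ('X * p), d, m.+1; split=> //; last 1 first.
- have prevX (q : {poly C}) : (size q <= m.+1)%N -> prev m.+1 q = fps_mon 1 1 * prev m q.
    move=> sq; have := @prevM 1 m 1 q; rewrite mul1r size_poly1 => -> //.
    by rewrite -(expr0 'X) prevXn.
  have prevXp : prev m.+1 ('X * p) = prev m p.
    have := @prevM 1 m 'X p; rewrite size_polyX => -> //.
    by rewrite -(expr1 'X) prevXn // subnn [fps_mon 1 0](_ : _ = 1) ?mul1r.
  split; first by apply: prev_neq0 => //; apply: leqW.
  exists e.+1, F; split=> //.
  have -> : fps_mon 1 e.+1 = fps_mon 1 e * fps_mon 1 1 :> fps C.
    by rewrite fps_monM mulr1 addn1.
  rewrite prevX // prevXp.
  by rewrite -mulrA FE mulrCA mulrA.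
- have [->|p0] := eqVneq p 0; first by rewrite mulr0 size_poly0.
  by rewrite mulrC size_mulX.
- exact: leqW.
Qed.

Lemma inf_coef1 k : inf_coef (1 : ratf C) k = (k == 0)%:R.
Proof.
rewrite (@inf_coefE 1 (lau 0 1)).
  by rewrite /lau addr0; case: k => // n; rewrite fcoef1.
have prev1 : prev 0 1 = 1 by rewrite -(expr0 'X) prevXn.
exists 1, 1, 0%N; split; rewrite ?oner_neq0 ?size_poly1 //.
  by rewrite tof1 divr1.
split; first by rewrite prev1 oner_neq0.
exists 0%N, 1; split=> //; rewrite prev1 -[fps_mon 1 0]/(1 : fps C) //.
Qed.

Lemma inf_coef_bounded g : exists K : int, forall k, k < K -> inf_coef g k = 0.
Proof.
have [p [d [m [_ _ _ _]]]] := inf_coefP g.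
move=> [_ [e [F [_ ->]]]]; exists (- e%:Z) => k ke.
by case E : (k + e%:Z) => [n|//]; move: ke E; lia.
Qed.

Lemma inf_coef0 k : inf_coef (0 : ratf C) k = 0.
Proof. by have := inf_coefZ 0 0 k; rewrite mulr0 mul0r. Qed.

Lemma ratcD x y : ratc (x + y) = ratc x + ratc y :> ratf C.
Proof. by rewrite /ratc polyCD tofD. Qed.
Lemma ratcM x y : ratc (x * y) = ratc x * ratc y :> ratf C.
Proof. by rewrite /ratc polyCM tofM. Qed.
Lemma ratc0 : ratc 0 = 0 :> ratf C.
Proof. by rewrite /ratc polyC0; exact: rmorph0. Qed.
Lemma ratc1 : ratc 1 = 1 :> ratf C.
Proof. by rewrite /ratc polyC1 tof1. Qed.

Fact emb_is_zmod_morphism : zmod_morphism (@emb C).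
Proof.
by move=> f g; apply/fpsP => k /=; apply/eqP; rewrite eq_sym subr_eq -ratcD subrK.
Qed.
Fact emb_is_monoid_morphism : monoid_morphism (@emb C).
Proof.
split=> [|f g]; apply/fpsP => k /=.
  by case: eqP; rewrite ?ratc1 ?ratc0.
rewrite (big_morph _ ratcD ratc0); apply: eq_bigr => i _; exact: ratcM.
Qed.
HB.instance Definition _ :=
  GRing.isZmodMorphism.Build (fps C) (ratfh C) (@emb C) emb_is_zmod_morphism.
HB.instance Definition _ :=
  GRing.isMonoidMorphism.Build (fps C) (ratfh C) (@emb C) emb_is_monoid_morphism.

Implicit Type G : ratfh C.

Lemma inf_coefhD G G' k : inf_coefh (G + G') k = inf_coefh G k + inf_coefh G' k.
Proof. by apply/fpsP => n /=; rewrite inf_coefD. Qed.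

Lemma inf_coefh_emb c G k : inf_coefh (emb c * G) k = c * inf_coefh G k.
Proof.
apply/fpsP => n /=; rewrite (big_morph (fun x => inf_coef x k) (fun x y => inf_coefD x y k) (inf_coef0 k)).
by apply: eq_bigr => i _; rewrite inf_coefZ.
Qed.

Lemma inf_coefh_zh G k : inf_coefh (zh C * G) k = inf_coefh G (k + 1).
Proof.
apply/fpsP => n.
rewrite -[LHS]/(inf_coef (fcoef (fps_mon (ratz C) 0 * G) n) k).
by rewrite fcoef_monM subn0 inf_coef_ratz.
Qed.

Lemma inf_coefh1 k : inf_coefh (1 : ratfh C) k = (k == 0)%:R.
Proof.
apply/fpsP => n /=; case: eqP => [->|/eqP n0].
  by rewrite inf_coef1; case: (k == 0).
by rewrite inf_coef0; case: (k == 0); rewrite //= (negPf n0).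
Qed.

(** The pole orders of the coefficients of h^0, h^1, ... may grow without bound, so the expansion is
    bounded below only modulo each h^n. *)
Lemma inf_coefh_bounded n G :
  exists K : int, forall k, k < K -> hdvd (M := (fps C)^o) n (inf_coefh G k).
Proof.
elim: n => [|n [K hK]].
  by exists 0 => k _; apply/(@hdvdP C C^o).
case: (inf_coef_bounded (fcoef G n)) => K' hK'.
exists (Num.min K K') => k kmin.
have [kK kK'] : k < K /\ k < K' by lia.
apply/(@hdvdP C C^o) => l; rewrite ltnS leq_eqVlt => /orP[/eqP ->|ln].
  exact: hK'.
by have /(@hdvdP C C^o) := hK k kK; apply.
Qed.

End ExpansionAtInfinity.

(** * Evaluation on h-adic limits *)

Section LimitEvaluation.
Variables (A : comNzRingType) (S : tower A) (C : fieldType) (W0 : lmodType C).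
Local Notation W := (fps W0).
Variable ev : S -> W.
Hypothesis evP : forall n x y, tw_eq n x y -> hdvd n (ev x - ev y).

Lemma hdvd_leq m n (w : W) : (m <= n)%N -> hdvd n w -> hdvd m w.
Proof.
move=> mn /hdvdP hw; apply/hdvdP => k km; apply: hw; exact: leq_trans km mn.
Qed.

(** The map hlim S -> W induced by [ev]. *)
Definition lim_ev (x : hlim S) : W :=
  Fps (fun k => fcoef (ev (repr x k.+1)) k).

Lemma thread_ev (s : thread S) m n : (m <= n)%N -> hdvd m (ev (s n) - ev (s m)).
Proof.
elim: n => [|n IH]; first by rewrite leqn0 => /eqP ->; rewrite subrr; exact: hdvd0.
rewrite leq_eqVlt => /orP[/eqP ->|mn]; first by rewrite subrr; exact: hdvd0.
apply: hdvd_trans (IH _); last by rewrite -ltnS.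
by apply: (@hdvd_leq _ n); [rewrite -ltnS | apply/evP/th_coh].
Qed.

(** Coefficient k of [lim_ev] is read at level k + 1, the first level that determines it; coherence
    of the thread carries it to every higher level. *)
Lemma lim_evP x n : hdvd n (lim_ev x - ev (repr x n)).
Proof.
apply/hdvdP => k kn; apply/eqP; rewrite fcoefD fcoefN subr_eq0 eq_sym -subr_eq0.
by have /hdvdP/(_ k (leqnn _)) <- := thread_ev (repr x) kn.
Qed.

Lemma lim_ev_pi (s : thread S) n : hdvd n (lim_ev (\pi_(hlim S) s)%qT - ev (s n)).
Proof. exact: hdvd_trans (lim_evP _ n) (evP (hlim_reprP s n)). Qed.

Lemma lim_ev_in x : lim_ev (hlim_in x) = ev x.
Proof. by apply: hdvd_eq => n; apply: lim_ev_pi. Qed.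

Lemma lim_evD (evD : forall x y, ev (tw_add x y) = ev x + ev y) :
  {morph lim_ev : x y / x + y}.
Proof.
move=> x y; apply: hdvd_eq => n; apply: hdvd_trans (lim_ev_pi _ n) _.
rewrite /= evD opprD addrACA; apply: hdvdD; exact/hdvd_sym/lim_evP.
Qed.

Lemma lim_evZ a c (evZ : forall x, ev (tw_scale a x) = c *: ev x) x :
  lim_ev (a *: x) = c *: lim_ev x.
Proof.
apply: hdvd_eq => n; apply: hdvd_trans (lim_ev_pi _ n) _.
by rewrite /= evZ -scalerBr; apply/hdvdZ/hdvd_sym/lim_evP.
Qed.

End LimitEvaluation.

(** A scalar a that does not act on W, such as z, may still turn one evaluation into another; the
    limits then correspond in the same way. *)
Lemma lim_ev_scale (A : comNzRingType) (S : tower A) (C : fieldType)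
    (W0 : lmodType C) (ev ev' : S -> fps W0) a
    (evP : forall n x y, tw_eq n x y -> hdvd n (ev x - ev y))
    (evP' : forall n x y, tw_eq n x y -> hdvd n (ev' x - ev' y))
    (evZ : forall x, ev (tw_scale a x) = ev' x) x :
  lim_ev ev (a *: x) = lim_ev ev' x.
Proof.
apply: hdvd_eq => n; apply: hdvd_trans (lim_ev_pi evP _ n) _.
by rewrite /= evZ; apply/hdvd_sym/lim_evP.
Qed.

Lemma emb_mon (C : fieldType) n : emb (fps_mon 1 n) = fps_mon 1 n :> ratfh C.
Proof. by apply/fpsP => k /=; case: eqP; rewrite ?ratc0 ?ratc1. Qed.

(** * Evaluation of trilinear maps on the completed tensor square *)

Section TensorEvaluation.
Variables (C : fieldType) (V : lmodType (fps C)) (W0 : lmodType C).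
Local Notation W := (fps W0).
Implicit Types (B : V -> V -> ratfh C -> W) (f g : ratfh C).

(** B u v g stands for the value at g times u (x) v. The coefficient g is an argument because only
    its constants, through [emb], can be moved to scalars of W. *)
Record trilinear B := Trilinear {
  trilDl : forall u u' v g, B (u + u') v g = B u v g + B u' v g;
  trilDr : forall u v v' g, B u (v + v') g = B u v g + B u v' g;
  trilD : forall u v f g, B u v (f + g) = B u v f + B u v g;
  trilZl : forall a u v g, B (a *: u) v g = a *: B u v g;
  trilZr : forall a u v g, B u (a *: v) g = a *: B u v g;
  trilZ : forall a u v g, B u v (emb a * g) = a *: B u v g
}.

(** The value at g times t: scalars met on the way down are accumulated in g until a pure tensor is
    reached. *)
Fixpoint ten_ev B (t : ten_term V) g : W :=
  match t with
  | TPure u v => B u v g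
  | TZero => 0
  | TAdd x y => ten_ev B x g + ten_ev B y g
  | TScale f x => ten_ev B x (f * g)
  end.

(* Rewriting with these two equations, rather than by simplification, keeps the
   kernel from comparing [f * g] with [g] by unfolding products of series. *)
Lemma ten_ev_add B x y g : ten_ev B (TAdd x y) g = ten_ev B x g + ten_ev B y g.
Proof. by []. Qed.
Lemma ten_ev_scale B f x g : ten_ev B (TScale f x) g = ten_ev B x (f * g).
Proof. by []. Qed.
Local Notation ten_evE := (ten_ev_add, ten_ev_scale).

Section Trilinear.
Variables (B : V -> V -> ratfh C -> W) (trilB : trilinear B).

Lemma ten_evD t f g : ten_ev B t (f + g) = ten_ev B t f + ten_ev B t g.
Proof.
elim: t f g => [u v||x IHx y IHy|e x IH] f g; rewrite ?ten_evE; first exact: trilD.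
- by rewrite /= addr0.
- by rewrite IHx IHy addrACA.
- by rewrite mulrDr IH.
Qed.

Lemma ten_evZ t a g : ten_ev B t (emb a * g) = a *: ten_ev B t g.
Proof.
elim: t g => [u v||x IHx y IHy|e x IH] g; rewrite ?ten_evE; first exact: trilZ.
- by rewrite /= scaler0.
- by rewrite IHx IHy scalerDr.
- by rewrite mulrCA IH.
Qed.

(** All g are treated at once, since the congruence under [TScale] changes the accumulated
    scalar. *)
Lemma ten_evP n x y : ten_cong n x y ->
  forall g, hdvd n (ten_ev B x g - ten_ev B y g).
Proof.
have H0 (w : W) : hdvd n (w - w) by rewrite subrr; exact: hdvd0.
elim=> {x y}.
- by move=> x g.
- by move=> x y _ IH g; apply/hdvd_sym/IH.
- by move=> x y z _ IH1 _ IH2 g; exact: hdvd_trans (IH1 g) (IH2 g).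
- by move=> x x' y y' _ IH1 _ IH2 g; rewrite !ten_evE opprD addrACA; apply: hdvdD.
- by move=> f x x' _ IH g; rewrite !ten_evE; apply: IH.
- by move=> x y z g; rewrite !ten_evE addrA.
- by move=> x y g; rewrite !ten_evE [_ + ten_ev B x g]addrC.
- by move=> x g; rewrite !ten_evE add0r.
- move=> x g; rewrite !ten_evE. have -> : -1 = emb (- 1) :> ratfh C by rewrite rmorphN1.
  by rewrite ten_evZ scaleN1r addNr.
- by move=> f f' x g; rewrite !ten_evE mulrA [f' * f]mulrC.
- by move=> x g; rewrite !ten_evE mul1r.
- by [].
- by move=> f f' x g; rewrite !ten_evE mulrDl ten_evD.
- by move=> x g; rewrite !ten_evE ?subr0 -emb_mon ten_evZ; apply: hdvd_mon.
- by move=> u u' v g /=; rewrite trilDl.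
- by move=> u v v' g /=; rewrite trilDr.
- by move=> a u v g /=; rewrite trilZl ?trilZ.
- by move=> a u v g /=; rewrite trilZr ?trilZ.
Qed.

Local Notation ev := (fun t : ten_tower V => ten_ev B t 1).

Lemma ten_evP1 n (x y : ten_tower V) : tw_eq n x y -> hdvd n (ev x - ev y).
Proof. by move=> /= /ten_evP. Qed.

Definition ten_lim : ten2 V -> W := lim_ev ev.

Lemma ten_limD : {morph ten_lim : x y / x + y}.
Proof. by apply: (lim_evD ten_evP1) => x y. Qed.

Lemma ten_lim0 : ten_lim 0 = 0.
Proof. by apply: (addrI (ten_lim 0)); rewrite -ten_limD !addr0. Qed.

Lemma ten_lim_sum (I : Type) (r : seq I) (P : pred I) (F : I -> ten2 V) :
  ten_lim (\sum_(i <- r | P i) F i) = \sum_(i <- r | P i) ten_lim (F i).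
Proof. exact: (big_morph _ ten_limD ten_lim0). Qed.

Lemma ten_limZ a (x : ten2 V) : ten_lim (emb a *: x) = a *: ten_lim x.
Proof. by apply: (lim_evZ ten_evP1) => t; rewrite /= ten_evZ. Qed.

Lemma ten_limN x : ten_lim (- x) = - ten_lim x.
Proof. by apply: (addrI (ten_lim x)); rewrite -ten_limD !subrr ten_lim0. Qed.

Lemma ten_lim_pure f u v : ten_lim (f *: pure u v) = B u v f.
Proof.
have evP' n (x y : ten_tower V) :
    tw_eq n x y -> hdvd n (ten_ev B x f - ten_ev B y f).
  by move=> /= /ten_evP.
rewrite /ten_lim (@lim_ev_scale _ (ten_tower V) _ _ ev (fun t => ten_ev B t f)).
- exact: (lim_ev_in evP').
- exact: ten_evP1.
- exact: evP'.
- by move=> x; rewrite [tw_scale _ _]/= ten_ev_scale mulr1.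
Qed.

Lemma ten_lim_hdvd n (x : ten2 V) : hdvd n x -> hdvd n (ten_lim x).
Proof. by case=> y ->; rewrite -emb_mon ten_limZ; apply: hdvd_mon. Qed.

Definition ten_finite (x : ten2 V) := exists l : seq (ratfh C * (V * V)),
  x = \sum_(t <- l) t.1 *: pure t.2.1 t.2.2.

(** [ten_lim] preserves divisibility by h^n, so every candidate for [ten_lift] agrees with it modulo
    each h^n. For a finite sum it is itself a candidate, with the same list at every level. *)
Lemma ten_lift_finite x : ten_finite x -> ten_lift B x = ten_lim x.
Proof.
case=> l xE; rewrite /ten_lift; case: xgetP => [s _ /= hs|/(_ (ten_lim x)) []].
  apply: hdvd_eq => n; case: (hs n) => l' [/ten_lim_hdvd xl sl].
  apply: hdvd_trans sl _; apply: hdvd_sym.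
  have -> : \sum_(t <- l') B t.2.1 t.2.2 t.1 =
      ten_lim (\sum_(t <- l') t.1 *: pure t.2.1 t.2.2).
    by rewrite ten_lim_sum; apply: eq_bigr => t _; rewrite ten_lim_pure.
  by move: xl; rewrite ten_limD ten_limN.
move=> n; exists l; rewrite xE ten_lim_sum; split.
  by rewrite subrr; exact: hdvd0.
rewrite -sumrB big1 ?(hdvd0) // => [|t _]; first exact: hdvd0.
by rewrite ten_lim_pure subrr.
Qed.

End Trilinear.

Lemma ten_finiteD x y : ten_finite x -> ten_finite y -> ten_finite (x + y).
Proof. by move=> [l ->] [l' ->]; exists (l ++ l'); rewrite big_cat. Qed.

Lemma ten_finite_sum (I : Type) (r : seq I) (P : pred I) (F : I -> ten2 V) :
  (forall i, P i -> ten_finite (F i)) -> ten_finite (\sum_(i <- r | P i) F i).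
Proof.
move=> hF; apply: big_ind => //; last exact: ten_finiteD.
by exists [::]; rewrite big_nil.
Qed.

Lemma ten_finiteZ f x : ten_finite x -> ten_finite (f *: x).
Proof.
move=> [l ->]; exists [seq (f * t.1, t.2) | t <- l].
rewrite big_map scaler_sumr; apply: eq_bigr => t _; by rewrite scalerA.
Qed.

Lemma ten_finite_pure u v : ten_finite (pure u v).
Proof. by exists [:: (1, (u, v))]; rewrite big_seq1 scale1r. Qed.

(** This is how z comes to act on values in W: for f = z, the map B' is B at shifted exponents. *)
Lemma ten_lim_shift f B B' (trilB : trilinear B) (trilB' : trilinear B') :
  (forall u v g, B u v (f * g) = B' u v g) ->
  forall x, ten_lim B (f *: x) = ten_lim B' x.
Proof.
move=> BB'; apply: lim_ev_scale => [n x y|n x y|t]; last 1 first.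
rewrite [tw_scale _ _]/= ten_ev_scale.
(* The scalar 1 is generalized, because it changes under [TScale]. *)
elim: t 1 => [u v||x IHx y IHy|e x IH] g //; first exact: BB'.
- by rewrite !ten_evE IHx IHy.
- by rewrite !ten_evE mulrCA IH.
- exact: ten_evP1.
- exact: ten_evP1.
Qed.

End TensorEvaluation.

(** * Products of two fields *)

Section DifferenceOperator.
Variables (C : fieldType) (W0 : lmodType C).
Local Notation W := (fps W0).
Implicit Types (F G : int -> int -> W) (a b : int).

Lemma zdiff_ext r F G a b : (forall a b, F a b = G a b) ->
  zdiff r F a b = zdiff r G a b.
Proof. by move=> FG; apply: eq_bigr => i _; rewrite FG. Qed.

Lemma zdiffD r F G a b :
  zdiff r (fun a b => F a b + G a b) a b = zdiff r F a b + zdiff r G a b.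
Proof. by rewrite -big_split; apply: eq_bigr => i _; rewrite scalerDr. Qed.

Lemma zdiffZ r c F a b :
  zdiff r (fun a b => c *: F a b) a b = c *: zdiff r F a b.
Proof.
rewrite [RHS]scaler_sumr; apply: eq_bigr => i _; by rewrite !scalerA mulrC.
Qed.

Lemma zdiffB r F G a b :
  zdiff r (fun a b => F a b - G a b) a b = zdiff r F a b - zdiff r G a b.
Proof.
rewrite -scaleN1r -zdiffZ -zdiffD; apply: zdiff_ext => c d; by rewrite scaleN1r.
Qed.

Lemma zdiff_sum r (I : Type) (s : seq I) (F : I -> int -> int -> W) a b :
  zdiff r (fun a b => \sum_(i <- s) F i a b) a b = \sum_(i <- s) zdiff r (F i) a b.
Proof.
elim: s => [|i s IH].
  by rewrite big_nil /zdiff big1 // => i _; rewrite big_nil scaler0.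
rewrite big_cons -IH -zdiffD; apply: zdiff_ext => c d; by rewrite big_cons.
Qed.

Lemma zdiff_shift r x y F a b :
  zdiff r (fun a b => F (a + x) (b + y)) a b = zdiff r F (a + x) (b + y).
Proof. by apply: eq_bigr => i _; rewrite !(addrAC _ (- _)). Qed.

(** Pascal's rule, that is, (z_1 - z_2)^(r+1) = z_1 (z_1 - z_2)^r - z_2 (z_1 - z_2)^r. *)
Lemma zdiffS r F a b :
  zdiff r.+1 F a b = zdiff r F (a - 1) b - zdiff r F a (b - 1).
Proof.
pose c i : fps C := fps_const ((-1) ^+ i * 'C(r, i)%:R).
pose T i := F (a - (r - i)%N%:Z) (b - 1 - i%:Z).
have e1 : zdiff r F (a - 1) b =
    F (a - r.+1%:Z) b + \sum_(i < r.+1) c i.+1 *: T i.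
  rewrite /zdiff big_ord_recl bin0 mulr1 expr0 subr0 subn0 scale1r; congr (_ + _).
    by congr F; lia.
  (* The sum gets one extra term, of coefficient 'C(r, r.+1) = 0, so that both sums have the same
     range. *)
  have cr : c r.+1 = 0.
    by rewrite /c bin_small // mulr0; apply/fpsP => k /=; case: eqP.
  rewrite [RHS]big_ord_recr [X in _ = _ + X](_ : _ = 0) ?addr0; last first.
    by rewrite [c _]cr scale0r.
  apply: eq_bigr => i _; rewrite lift0 /T /=; have ir := ltn_ord i.
  by congr (_ *: F _ _); lia.
have e2 : zdiff r F a (b - 1) = \sum_(i < r.+1) c i *: T i by [].
rewrite e1 e2 /zdiff big_ord_recl bin0 mulr1 expr0 subr0 subn0 scale1r -addrA.
congr (_ + _); rewrite -sumrB; apply: eq_bigr => i _; rewrite lift0 subSS -scalerBl.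
have -> : F (a - (r - i)%N%:Z) (b - i.+1%:Z) = T i by congr F; lia.
congr (_ *: _).
rewrite /c binS natrD exprS; apply/fpsP => k /=.
by case: eqP => _; rewrite ?subr0 // mulrDr !mulN1r !mulNr addrC.
Qed.

Lemma zdiff_hdvd_leq n r r' F : (r <= r')%N ->
  (forall a b, hdvd n (zdiff r F a b)) -> forall a b, hdvd n (zdiff r' F a b).
Proof.
move=> /subnK <-; elim: (r' - r)%N => [|k IH] // hF a b.
by rewrite addSn zdiffS; apply: hdvdB; apply: IH.
Qed.

(** Term i reads F at first exponent a - (r - i), which is below a unless i = r; only (-z_2)^r is
    left. *)
Lemma zdiff_lowest r F a b : (forall k l, k + l = a + b - r%:Z -> k < a -> F k l = 0) ->
  zdiff r F a b = fps_const ((-1) ^+ r) *: F a (b - r%:Z).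
Proof.
move=> F0; rewrite /zdiff big_ord_recr /= binn mulr1 subnn subr0 big1 ?add0r //.
move=> i _; rewrite F0 ?scaler0 //; have := ltn_ord i; lia.
Qed.

End DifferenceOperator.

(** * Products of two fields twisted by a rational function of z_1/z_2 *)

Section FieldProducts.
Variables (C : fieldType) (V : lmodType (fps C)) (W0 : lmodType C).
Local Notation W := (fps W0).
Variable YW : V -> int -> W -> W.
Hypothesis YWl : forall v k, linear (YW v k).
Hypothesis YWlv : forall k w, linear (fun v => YW v k w).
Hypothesis YWh : forall v w, hlaurent (fun k => YW v k w).

Lemma hdvd_scale n (c : fps C) (w : W) : hdvd (M := (fps C)^o) n c -> hdvd n (c *: w).
Proof. by case=> d ->; exists (d *: w); rewrite scalerA. Qed.

Lemma linear_hdvd n (f : W -> W) w : linear f -> hdvd n w -> hdvd n (f w).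
Proof.
move=> lf [x ->]; exists (f x).
have f0 : f 0 = 0.
  by apply: (addrI (f 0)); have := lf 1 0 0; rewrite scaler0 !addr0 scale1r => <-.
by have := lf (fps_mon 1 n) x 0; rewrite f0 !addr0.
Qed.

Definition sigma_term (w : W) (a b : int) (u v : V) (g : ratfh C) (d : int) : W :=
  inf_coefh g d *: YW u (a + d) (YW v (b - d) w).

(** Modulo h^n, the expansion coefficient vanishes for d < K and the inner field for b - d < K',
    which leaves the finite interval from K to b - K'. *)
Lemma sigma_term_summable w a b u v g : summable (sigma_term w a b u v g).
Proof.
move=> n; case: (inf_coefh_bounded n g) => K hK; case: (YWh v w n) => K' hK'.
pose l := (absz (b - K' - K)%R).+1.
exists [seq K + i%:Z | i <- iota 0 l] => d dn.
have [dK|Kd] : d < K \/ K <= d by lia.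
  exact/hdvd_scale/hK.
apply/hdvdZ/linear_hdvd/hK'; first exact: YWl.
have [//|h] : b - d < K' \/ d <= b - K' by lia.
case/negP: dn; apply/mapP; exists (absz (d - K)%R); last by lia.
by rewrite mem_iota /l; lia.
Qed.

Definition sigma_eval (w : W) (a b : int) (u v : V) (g : ratfh C) : W :=
  hsum (sigma_term w a b u v g).

Let hsE w a b u v g := hsumP (sigma_term_summable w a b u v g).

Let YWD u u' k w : YW (u + u') k w = YW u k w + YW u' k w.
Proof. by have := YWlv k w 1 u u'; rewrite !scale1r. Qed.
Let YW0 k w : YW 0 k w = 0.
Proof. by apply: (addrI (YW 0 k w)); rewrite -YWD !addr0. Qed.
Let YWZ c u k w : YW (c *: u) k w = c *: YW u k w.
Proof. by have := YWlv k w c u 0; rewrite YW0 !addr0. Qed.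
Let YWDr u k w w' : YW u k (w + w') = YW u k w + YW u k w'.
Proof. by have := YWl u k 1 w w'; rewrite !scale1r. Qed.
Let YW0r u k : YW u k 0 = 0.
Proof. by apply: (addrI (YW u k 0)); rewrite -YWDr !addr0. Qed.
Let YWZr c u k w : YW u k (c *: w) = c *: YW u k w.
Proof. by have := YWl u k c w 0; rewrite YW0r !addr0. Qed.

Lemma sigma_eval_trilinear w a b : trilinear (sigma_eval w a b).
Proof.
split=> [u u' v g|u v v' g|u v f g|c u v g|c u v g|c u v g]; apply: hsumE.
- have := hsumsD (hsE w a b u v g) (hsE w a b u' v g).
  congr hsums; apply: funext => d; by rewrite /sigma_term YWD scalerDr.
- have := hsumsD (hsE w a b u v g) (hsE w a b u v' g).
  congr hsums; apply: funext => d; by rewrite /sigma_term YWD YWDr scalerDr.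
- have := hsumsD (hsE w a b u v f) (hsE w a b u v g).
  congr hsums; apply: funext => d; by rewrite /sigma_term inf_coefhD scalerDl.
- have := hsumsZ c (hsE w a b u v g).
  congr hsums; apply: funext => d; by rewrite /sigma_term YWZ !scalerA mulrC.
- have := hsumsZ c (hsE w a b u v g).
  by congr hsums; apply: funext => d; rewrite /sigma_term YWZ YWZr !scalerA mulrC.
- have := hsumsZ c (hsE w a b u v g).
  congr hsums; apply: funext => d; by rewrite /sigma_term inf_coefh_emb scalerA.
Qed.

(** Multiplication by z moves the expansion coefficients by one; reindexing d transfers this to the
    exponents of z_1 and z_2. *)
Lemma sigma_eval_zh w a b u v g :
  sigma_eval w a b u v (zh C * g) = sigma_eval w (a - 1) (b + 1) u v g.
Proof.
rewrite /sigma_eval -[RHS](@hsum_reindex _ _ _ (fun d => d + 1) (fun d => d - 1)).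
- congr hsum; apply: funext => d /=; rewrite /sigma_term inf_coefh_zh.
  by congr (_ *: YW _ _ (YW _ _ _)); lia.
- exact: addrK.
- exact: subrK.
- exact: sigma_term_summable.
Qed.

Lemma sigma_eval1 w a b u v : sigma_eval w a b u v 1 = YW u a (YW v b w).
Proof.
rewrite /sigma_eval (@hsum_single _ _ _ _ 0) => [|d /negPf d0].
  by rewrite /sigma_term inf_coefh1 scale1r addr0 subr0.
by rewrite /sigma_term inf_coefh1 d0 scale0r.
Qed.

Definition sigma_lim (w : W) (a b : int) : ten2 V -> W := ten_lim (sigma_eval w a b).

Lemma sigma_limD w a b : {morph sigma_lim w a b : x y / x + y}.
Proof. exact: ten_limD (sigma_eval_trilinear w a b). Qed.

Lemma sigma_limZ w a b c x : sigma_lim w a b (emb c *: x) = c *: sigma_lim w a b x.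
Proof. exact: ten_limZ (sigma_eval_trilinear w a b) _ _. Qed.

Lemma sigma_lim_sum w a b (I : Type) (r : seq I) (P : pred I) (F : I -> ten2 V) :
  sigma_lim w a b (\sum_(i <- r | P i) F i) =
  \sum_(i <- r | P i) sigma_lim w a b (F i).
Proof. exact: ten_lim_sum (sigma_eval_trilinear w a b) _ _ _ _. Qed.

Lemma sigma_lim_zh w a b x :
  sigma_lim w a b (zh C *: x) = sigma_lim w (a - 1) (b + 1) x.
Proof.
apply: ten_lim_shift; try exact: sigma_eval_trilinear; exact: sigma_eval_zh.
Qed.

Lemma sigma_lim_pure w a b u v : sigma_lim w a b (pure u v) = YW u a (YW v b w).
Proof.
by rewrite -sigma_eval1 -(ten_lim_pure (sigma_eval_trilinear w a b)) scale1r.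
Qed.

Lemma sigma_lim_finite w a b x : ten_finite x ->
  ten_lift (sigma_eval w a b) x = sigma_lim w a b x.
Proof. exact: ten_lift_finite (sigma_eval_trilinear w a b) _. Qed.

End FieldProducts.

(** * Actions of presented algebras *)

Section PresentedAction.
Variables (C : fieldType) (X : Type) (rel : nat -> alg_term C X -> alg_term C X -> Prop).
Variable W0 : lmodType C.
Local Notation W := (fps W0).
Variable op : X -> W -> W.

Fixpoint alg_ev (t : alg_term C X) (w : W) : W :=
  match t with
  | AGen x => op x w
  | ACst a => a *: w
  | AAdd x y => alg_ev x w + alg_ev y w
  | AMul x y => alg_ev x (alg_ev y w)
  end.

Lemma alg_ev_cst a w : alg_ev (ACst X a) w = a *: w. Proof. by []. Qed.
Lemma alg_ev_add x y w : alg_ev (AAdd x y) w = alg_ev x w + alg_ev y w.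
Proof. by []. Qed.
Lemma alg_ev_mul x y w : alg_ev (AMul x y) w = alg_ev x (alg_ev y w).
Proof. by []. Qed.
Local Notation alg_evE := (alg_ev_cst, alg_ev_add, alg_ev_mul).

Lemma alg_ev_sum (I : Type) (r : seq I) (P : pred I) (F : I -> alg_term C X) w :
  alg_ev (\big[@AAdd _ _/ACst _ 0]_(i <- r | P i) F i) w =
  \sum_(i <- r | P i) alg_ev (F i) w.
Proof.
apply: (big_morph (fun t => alg_ev t w)) => //; first exact: scale0r.
Qed.

Hypothesis op_linear : forall x, linear (op x).
Hypothesis rel_op : forall n x y, rel n x y ->
  forall w, hdvd n (alg_ev x w - alg_ev y w).

Lemma alg_ev_linear t : linear (alg_ev t).
Proof.
elim: t => [x|b|x IHx y IHy|x IHx y IHy] a u v; rewrite ?alg_evE.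
- exact: op_linear.
- by rewrite scalerDr !scalerA mulrC.
- by rewrite IHx IHy scalerDr addrACA.
- by rewrite IHy IHx.
Qed.

Lemma alg_ev0 t : alg_ev t 0 = 0.
Proof.
by apply: (addrI (alg_ev t 0)); have := alg_ev_linear t 1 0 0;
  rewrite scaler0 !addr0 scale1r => <-.
Qed.
Lemma alg_evZ t a w : alg_ev t (a *: w) = a *: alg_ev t w.
Proof. by have := alg_ev_linear t a w 0; rewrite alg_ev0 !addr0. Qed.
Lemma alg_evB t u v : alg_ev t (u - v) = alg_ev t u - alg_ev t v.
Proof. by rewrite addrC -scaleN1r alg_ev_linear scaleN1r addrC. Qed.

Lemma alg_evP n x y : alg_cong rel n x y ->
  forall w, hdvd n (alg_ev x w - alg_ev y w).
Proof.
have E (u v : W) : u = v -> hdvd n (u - v).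
  by move=> ->; rewrite subrr; exact: hdvd0.
elim=> {x y}.
- by move=> x w; apply: E.
- by move=> x y _ IH w; apply/hdvd_sym/IH.
- by move=> x y z _ IH1 _ IH2 w; exact: hdvd_trans (IH1 w) (IH2 w).
- move=> x x' y y' _ IH1 _ IH2 w; rewrite !alg_evE opprD addrACA.
  exact: hdvdD.
- move=> x x' y y' _ IH1 _ IH2 w; rewrite !alg_evE.
  (* The left factor is exchanged at the vector [alg_ev y w], then the right factor under the linear
     operator of x'. *)
  apply: hdvd_trans (IH1 _) _; rewrite -alg_evB.
  apply: linear_hdvd; [exact: alg_ev_linear | exact: IH2].
- by move=> x y z w; apply: E; rewrite !alg_evE addrA.
- by move=> x y w; apply: E; rewrite !alg_evE addrC.
- by move=> x w; apply: E; rewrite !alg_evE scale0r add0r.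
- by move=> x y z w; apply: E.
- by move=> x w; apply: E; rewrite !alg_evE scale1r.
- by move=> x w; apply: E; rewrite !alg_evE scale1r.
- by move=> x w; apply: E; rewrite !alg_evE !scale0r.
- by move=> x y z w; apply: E.
- move=> x y z w; apply: E; rewrite !alg_evE.
  by have := alg_ev_linear x 1 (alg_ev y w) (alg_ev z w); rewrite !scale1r.
- by move=> a b w; apply: E; rewrite !alg_evE scalerDl.
- by move=> a b w; apply: E; rewrite !alg_evE scalerA.
- by move=> a x w; apply: E; rewrite !alg_evE alg_evZ.
- by move=> w; rewrite !alg_evE scale0r subr0; apply: hdvd_mon.
- by move=> x y; apply: rel_op.
Qed.

Local Notation ev w := (fun t : presented rel => alg_ev t w).

Let evP w n (x y : presented rel) : tw_eq n x y -> hdvd n (ev w x - ev w y).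
Proof. by move=> /= /alg_evP. Qed.

Definition alg_act (a : palg rel) (w : W) : W := lim_ev (ev w) a.

Lemma alg_actP a w n : hdvd n (alg_act a w - alg_ev (repr (a : hlim (presented rel)) n) w).
Proof. exact: (lim_evP (evP w)). Qed.

Lemma alg_act_linear a : linear (alg_act a).
Proof.
move=> k u v; apply: hdvd_eq => n; apply: hdvd_trans (alg_actP _ _ n) _.
rewrite alg_ev_linear; apply: hdvd_sym; rewrite opprD addrACA -scalerBr.
by apply: hdvdD; [apply: hdvdZ|]; apply: alg_actP.
Qed.

Lemma alg_act_linearl w : linear (alg_act^~ w).
Proof.
move=> k a b; rewrite /alg_act (lim_evD (evP w)); last by [].
by congr (_ + _); apply: (lim_evZ (evP w)).
Qed.

Lemma alg_act1 w : alg_act 1 w = w.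
Proof.
rewrite -[RHS]scale1r -(alg_ev_cst 1 w); exact: (lim_ev_in (evP w) (ACst X 1)).
Qed.

Lemma alg_actM a b w : alg_act (a * b) w = alg_act a (alg_act b w).
Proof.
apply: hdvd_eq => n; apply: hdvd_trans (lim_ev_pi (evP w) _ n) _.
rewrite [th_seq _ _]/= alg_ev_mul; apply: hdvd_sym.
apply: hdvd_trans (alg_actP _ _ n) _; rewrite -alg_evB.
by apply: linear_hdvd; [exact: alg_ev_linear | exact: alg_actP].
Qed.

Lemma alg_act_gen x w : alg_act (pgen rel x) w = op x w.
Proof. exact: (lim_ev_in (evP w) (AGen C x)). Qed.

End PresentedAction.

(** * Inverses of two-fold tensors *)

Local Notation s0 := (lshift 1 (ord0 : 'I_1)).
Local Notation s1 := (rshift 1 (ord0 : 'I_1)).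

Lemma ord11P (P : 'I_(1 + 1) -> Prop) : P s0 -> P s1 -> forall t, P t.
Proof. by move=> h0 h1 t; case: (split_ordP t) => j ->; rewrite (ord1 j). Qed.

Lemma forall_ord11 (P : pred 'I_(1 + 1)) : [forall t, P t] = P s0 && P s1.
Proof.
apply/forallP/andP => [h|[h0 h1]]; first by split; apply: h.
exact: ord11P.
Qed.

Definition mk2 (T : Type) (x y : T) : {ffun 'I_(1 + 1) -> T} :=
  [ffun t => if t == s0 then x else y].

Lemma mk2_0 (T : Type) (x y : T) : mk2 x y s0 = x. Proof. by rewrite ffunE eqxx. Qed.
Lemma mk2_1 (T : Type) (x y : T) : mk2 x y s1 = y. Proof. by rewrite ffunE. Qed.
Lemma ffun11P (T : Type) (f g : {ffun 'I_(1 + 1) -> T}) :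
  f s0 = g s0 -> f s1 = g s1 -> f = g.
Proof. by move=> h0 h1; apply/ffunP; apply: ord11P. Qed.
Lemma mk2_eta (T : Type) (f : {ffun 'I_(1 + 1) -> T}) : f = mk2 (f s0) (f s1).
Proof. by apply: ffun11P; rewrite ?mk2_0 ?mk2_1. Qed.

Lemma big_mk2 (T : finType) (D : zmodType) (P : pred {ffun 'I_(1 + 1) -> T})
    (F : {ffun 'I_(1 + 1) -> T} -> D) :
  \sum_(f | P f) F f = \sum_(x : T * T | P (mk2 x.1 x.2)) F (mk2 x.1 x.2).
Proof.
rewrite (reindex (fun x : T * T => mk2 x.1 x.2)) //.
exists (fun f : {ffun 'I_(1 + 1) -> T} => (f s0, f s1)) => [[x y] _|f _] /=.
  by rewrite mk2_0 mk2_1.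
by rewrite -mk2_eta.
Qed.

Section TensorInverse.
Variable N : nat.
Local Notation tser2 := (tser N (1 + 1)).
Local Notation idx2 := (idx N (1 + 1)).

Definition e0 k : expo k := [ffun=> 0%N].

Lemma tmul_e0 k (o : pred 'I_k) (A B : Type) (D : zmodType) (op : A -> B -> D)
    (X : tser N k A) (Y : tser N k B) (i l : idx N k) :
  tmul o op X Y i l (e0 k) = \sum_j
    op (X (sel o i j) (sel o j l) (e0 k)) (Y (sel o j i) (sel o l j) (e0 k)).
Proof.
apply: eq_bigr => j _; rewrite (bigD1 [ffun=> ord0]) /=; last first.
  by apply/forallP => t; rewrite !ffunE.
rewrite [X in _ + X]big1 ?addr0 => [|b /andP[/forallP b0 /eqP nb]].
  by congr op; congr (_ _); apply/ffunP => t; rewrite !ffunE.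
by case: nb; apply/ffunP => t; apply/val_inj; have := b0 t; rewrite !ffunE leqn0 => /eqP.
Qed.

Variable A : comNzRingType.
Variable o : pred 'I_(1 + 1).

(* Transposing the factors in [o] turns the multiplication [tmul o] into that
   of matrices over A[[w_1]][[w_2]]. *)
Definition tmx (X : tser2 A) : 'M[fps (fps A)]_#|{: idx2}| :=
  \matrix_(a, b) Fps (fun p => Fps (fun q =>
    X (sel o (enum_val a) (enum_val b)) (sel o (enum_val b) (enum_val a)) (mk2 p q))).

Lemma selK k (o' : pred 'I_k) (i j : idx N k) : sel o' (sel o' i j) (sel o' j i) = i.
Proof. by apply/ffunP => t; rewrite !ffunE; case: (o' t). Qed.

Lemma tmx_inj : injective tmx.
Proof.
move=> X Y /matrixP XY; apply: funext => i; apply: funext => j; apply: funext => e.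
have := XY (enum_rank (sel o i j)) (enum_rank (sel o j i)).
rewrite !mxE !enum_rankK !selK => /fpsP/(_ (e s0)) /fpsP/(_ (e s1)) /=.
by rewrite -mk2_eta.
Qed.

Lemma tmx_surj M : exists X, tmx X = M.
Proof.
exists (fun i j e => fcoef (fcoef (M (enum_rank (sel o i j)) (enum_rank (sel o j i)))
   (e s0)) (e s1)).
apply/matrixP => a b; rewrite mxE; apply/fpsP => p; apply/fpsP => q /=.
by rewrite !selK !enum_valK mk2_0 mk2_1.
Qed.

Lemma tmx1 : tmx (tone (k := 1 + 1) A) = 1%:M.
Proof.
apply/matrixP => a b; rewrite !mxE; apply/fpsP => p; apply/fpsP => q.
have E : [forall t, mk2 p q t == 0%N] = (p == 0%N) && (q == 0%N).
  transitivity ((mk2 p q s0 == 0%N) && (mk2 p q s1 == 0%N)).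
    exact: (forall_ord11 (fun t => mk2 p q t == 0%N)).
  by rewrite mk2_0 mk2_1.
rewrite /= /tone E {E}.
have -> : (sel o (enum_val a) (enum_val b) == sel o (enum_val b) (enum_val a)) = (a == b).
  apply/eqP/eqP => [ab|-> //].
  apply: enum_val_inj; have := selK o (enum_val a) (enum_val b).
  by rewrite {1}ab -[X in sel _ _ X]ab selK.
by case: (a == b); case: p => [|p]; case: q => [|q].
Qed.

Lemma tmxM X Y : tmx (tmul o *%R X Y) = tmx X *m tmx Y.
Proof.
apply/matrixP => a b; rewrite !mxE; apply/fpsP => p; apply/fpsP => q.
rewrite !fcoef_sum [LHS]/= /tmul.
rewrite (eq_bigl (fun j => j \in {: idx2})) // big_enum_val.
apply: eq_bigr => c _; rewrite !mxE !fcoefM fcoef_sum.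
rewrite big_mk2.
set i := enum_val a; set l := enum_val b; set j := enum_val c.
set D := \sum_t _.
(* [tmul] lets both exponents range up to the total degree p + q and filters them; the Cauchy
   products stop at p and at q, so these are widened to the common range. *)
have pD : (p < D.+1)%N by rewrite ltnS /D big_split_ord !big_ord1 mk2_0 leq_addr.
have qD : (q < D.+1)%N by rewrite ltnS /D big_split_ord !big_ord1 mk2_1 leq_addl.
pose G (x y : nat) := X (sel o i j) (sel o j i) (mk2 x y) *
  Y (sel o j l) (sel o l j) (mk2 (p - x)%N (q - y)%N).
transitivity (\sum_(x < p.+1) \sum_(y < q.+1) G x y); last first.
  by apply: eq_bigr => x _; rewrite fcoefM.
rewrite (big_ord_widen D.+1 (fun x => \sum_(y < q.+1) G x y)) //.
rewrite (eq_bigr (fun x : 'I_D.+1 => \sum_(y < D.+1 | (y < q.+1)%N) G x y)); last first.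
  by move=> x _; rewrite (big_ord_widen D.+1 (G x)).
rewrite pair_big_dep /=; apply: eq_big => [[x y]|[x y] _].
  transitivity ((mk2 x y s0 <= mk2 p q s0) && (mk2 x y s1 <= mk2 p q s1))%N.
    exact: (forall_ord11 (fun t => mk2 x y t <= mk2 p q t)%N).
  by rewrite !mk2_0 !mk2_1.
rewrite /G; congr (X _ _ _ * Y _ _ _).
all: try by apply/ffunP => t; rewrite !ffunE; case: (o t).
all: by apply: ffun11P; rewrite !ffunE /= ?eqxx.
Qed.

End TensorInverse.

Lemma fps_unit_cst_unit (A : comUnitRingType) (f : fps A) :
  fcoef f 0 \is a GRing.unit -> f \is a GRing.unit.
Proof. by move=> uf; apply: (@fps_unit_cst _ _ (fcoef f 0)^-1); apply: mulrV. Qed.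

(** X is the identity modulo h and the two variables, and transposing tensor factors keeps the
    identity. The determinant of [tmx o X] thus has constant term 1 in three nested series rings and
    is a unit. *)
Lemma tinvP N (F : fieldType) (o : pred 'I_(1 + 1)) (X : tser N (1 + 1) (fps F)) :
  (forall i j, fcoef (X i j (e0 _)) 0 = (i == j)%:R) ->
  tmul o *%R X (tinv o X) = tone (fps F) /\ tmul o *%R (tinv o X) X = tone (fps F).
Proof.
move=> X0; pose cst := @fps_cst F \o @fps_cst (fps F) \o @fps_cst (fps (fps F)).
have uX : tmx o X \in unitmx.
  rewrite unitmxE; do 2 apply: fps_unit_cst_unit; apply: fps_field_unit.
  have -> : fcoef (fcoef (fcoef (\det (tmx o X)) 0) 0) 0 = \det (map_mx cst (tmx o X)).
    by rewrite det_map_mx.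
  rewrite (_ : map_mx _ _ = 1%:M) ?det1 ?oner_neq0 //.
  apply/matrixP => a b; rewrite !mxE /cst /= /fps_cst /=.
  have -> : mk2 0%N 0%N = e0 (1 + 1) by apply: ffun11P; rewrite !ffunE.
  rewrite X0; congr (_ : bool)%:R; apply/eqP/eqP => [ab|-> //].
  apply: enum_val_inj; have := selK o (enum_val a) (enum_val b).
  by rewrite {1}ab -[X in sel _ _ X]ab selK.
case: (tmx_surj o (invmx (tmx o X))) => Y YE.
rewrite /tinv; case: xgetP => [Z _ [] //|/(_ Y) []].
by split; apply: (@tmx_inj _ _ o); rewrite tmxM YE tmx1 ?mulmxV ?mulVmx.
Qed.

(** * The exchange relation for sigma *)

Section ExchangeAlgebra.
Variables (K : comUnitRingType) (M : lmodType K).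

Lemma sum_inverse (J : finType) (U V : J -> J -> K) (X : J -> M) x :
  (forall z, \sum_y V y z * U x y = (x == z)%:R) ->
  \sum_y U x y *: (\sum_z V y z *: X z) = X x.
Proof.
move=> UV; under eq_bigr => y _ do rewrite scaler_sumr.
rewrite exchange_big (bigD1 x) //=.
have E z : \sum_y U x y *: (V y z *: X z) = (x == z)%:R *: X z.
  by rewrite -UV scaler_suml; apply: eq_bigr => y _; rewrite scalerA mulrC.
rewrite E eqxx scale1r big1 ?addr0 // => z /negPf zx.
by rewrite E eq_sym zx scale0r.
Qed.

(** R clears R', then Rz clears Ri. The result has exactly one factor Rz on each side, so
    multiplying by s turns both into g Q, and only the unit g has to be cancelled. *)
Lemma exchange_identity (I : finType) (R R' Rz Ri Q : I -> I -> I -> I -> K)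
    (s g : K) (S T : I -> I -> I -> I -> M) :
  g \is a GRing.unit ->
  (forall i j k l, s * Rz i j k l = g * Q i j k l) ->
  (forall p a b q, \sum_i \sum_j R' i a b j * R p i j q =
     ((p == a) && (b == q))%:R) ->
  (forall c j d q, \sum_a \sum_b Ri c a d b * Rz b q a j =
     ((c == j) && (d == q))%:R) ->
  (forall i j k l, S i j k l = \sum_a \sum_b R' i a b l *:
     (\sum_c \sum_d Ri c j d b *: (\sum_e \sum_f Rz a e k f *: T e c f d))) ->
  forall p j' k q',
    \sum_j \sum_q Q q q' j j' *: (\sum_i \sum_l R p i l q *: S i j k l) =
    \sum_a \sum_b Q p a k b *: T a j' b q'.
Proof.
move=> ug RQ hR hRz hS p j' k q'.
pose Y a c d := \sum_e \sum_f Rz a e k f *: T e c f d.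
pose X a j b := \sum_c \sum_d Ri c j d b *: Y a c d.
(* Pairs of indices are taken as single matrix indices, grouped as the mixed multiplication
   contracts them. *)
have XE j q : \sum_i \sum_l R p i l q *: S i j k l = X p j q.
  under eq_bigr => i _ do under eq_bigr => l _ do rewrite hS pair_bigA.
  rewrite pair_bigA.
  apply: (@sum_inverse (I * I)%type (fun x y => R x.1 y.1 y.2 x.2)
    (fun y z => R' y.1 z.1 z.2 y.2) (fun z => X z.1 j z.2) (p, q)) => -[a b].
  by rewrite -(pair_bigA _ (fun i l => R' i a b l * R p i l q)) hR xpair_eqE [b == q]eq_sym.
have YE : \sum_j \sum_q Rz q q' j j' *: X p j q = Y p j' q'.
  under eq_bigr => j _ do under eq_bigr => q _ do rewrite /X pair_bigA.
  rewrite pair_bigA.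
  apply: (@sum_inverse (I * I)%type (fun x y => Rz y.2 x.2 y.1 x.1)
    (fun y z => Ri z.1 y.1 z.2 y.2) (fun z => Y p z.1 z.2) (j', q')) => -[c d].
  rewrite -(pair_bigA _ (fun a b => Ri c a d b * Rz b q' a j')) hRz xpair_eqE.
  by rewrite [c == _]eq_sym [d == _]eq_sym.
rewrite -[LHS]scale1r -[RHS]scale1r -(mulVr ug) -!scalerA; congr (_ *: _).
have sQ i j l m (x : M) : g *: (Q i j l m *: x) = s *: (Rz i j l m *: x).
  by rewrite !scalerA RQ.
transitivity (s *: (\sum_j \sum_q Rz q q' j j' *: X p j q)).
  rewrite !scaler_sumr; apply: eq_bigr => j _; rewrite !scaler_sumr.
  by apply: eq_bigr => q _; rewrite sQ XE.
rewrite YE !scaler_sumr; apply: eq_bigr => a _; rewrite !scaler_sumr.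
by apply: eq_bigr => b _; rewrite sQ.
Qed.

End ExchangeAlgebra.

(** * Constant terms of tensors with two matrix factors *)

Section TwoFactors.
Variable N : nat.
Local Notation I := 'I_N.
Local Notation tser2 := (tser N (1 + 1)).

(** The constant term of the coefficient of e_ij (x) e_kl. *)
Definition entry A (X : tser2 A) (i j k l : I) : A := X (mk2 i k) (mk2 j l) (e0 _).

Lemma sum_idx2 (D : zmodType) (F : idx N (1 + 1) -> D) :
  \sum_j F j = \sum_a \sum_b F (mk2 a b).
Proof. by rewrite big_mk2 pair_bigA. Qed.

Lemma sel_mk2 (o : pred 'I_(1 + 1)) (a b c d : I) :
  sel o (mk2 a b) (mk2 c d) = mk2 (if o s0 then c else a) (if o s1 then d else b).
Proof. by apply: ffun11P; rewrite !ffunE /= ?eqxx. Qed.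

Lemma entry_tmul (A B : Type) (D : zmodType) (op : A -> B -> D) X Y i j k l :
  entry (tmul pred0 op X Y) i j k l =
  \sum_a \sum_b op (entry X i a k b) (entry Y a j b l).
Proof.
rewrite /entry tmul_e0 sum_idx2; apply: eq_bigr => a _; apply: eq_bigr => b _.
by rewrite !sel_mk2.
Qed.

Lemma entry_tmulLR (A B : Type) (D : zmodType) (op : A -> B -> D) X Y i j k l :
  entry (tmul (@LR 1 1) op X Y) i j k l =
  \sum_a \sum_b op (entry X i a b l) (entry Y a j k b).
Proof.
rewrite /entry tmul_e0 sum_idx2; apply: eq_bigr => a _; apply: eq_bigr => b _.
by rewrite !sel_mk2.
Qed.

Lemma entry_tmulRL (A B : Type) (D : zmodType) (op : A -> B -> D) X Y i j k l :
  entry (tmul (@RL 1 1) op X Y) i j k l =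
  \sum_a \sum_b op (entry X a j k b) (entry Y i a b l).
Proof.
rewrite /entry tmul_e0 sum_idx2; apply: eq_bigr => a _; apply: eq_bigr => b _.
by rewrite !sel_mk2.
Qed.

Lemma mk2_inj (i j k l : I) : (mk2 i k == mk2 j l) = (i == j) && (k == l).
Proof.
apply/eqP/andP => [/ffunP e|[/eqP -> /eqP ->] //].
by have := (e s0, e s1); rewrite !mk2_0 !mk2_1 => -[-> ->].
Qed.

Lemma e0E : [forall t, e0 (1 + 1) t == 0%N].
Proof. by apply/forallP => t; rewrite ffunE. Qed.

Lemma entry_tone (A : pzRingType) i j k l :
  entry (@tone N (1 + 1) A) i j k l = ((i == j) && (k == l))%:R.
Proof. by rewrite /entry /tone e0E andbT mk2_inj. Qed.

Lemma enum1 : enum 'I_1 = [:: ord0].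
Proof. by apply: (inj_map val_inj); rewrite val_enum_ord. Qed.

Lemma entry_tprod1 (A : pzRingType) (X : tser2 A) i j k l :
  entry (tprod [:: X]) i j k l = entry X i j k l.
Proof.
rewrite /= entry_tmul (bigD1 j) //= (bigD1 l) //= entry_tone !eqxx mulr1.
rewrite [X in _ + X + _]big1 ?addr0 => [|b /negPf bl]; last first.
  by rewrite entry_tone bl andbF mulr0.
rewrite big1 ?addr0 // => a /negPf aj; rewrite big1 // => b _.
by rewrite entry_tone aj mulr0.
Qed.

Lemma entry_place (A : zmodType) (F : nat -> nat -> mat2 N A) i j k l :
  entry (place F (s0, s1)) i j k l = F 0%N 0%N i j k l.
Proof.
rewrite /entry /place !mk2_0 !mk2_1 !ffunE ifT //.
by apply/forallP; apply: ord11P; rewrite !inE eqxx ?orbT.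
Qed.

Lemma entry_prod12 (A : pzRingType) (F : mat2 N A -> nat -> nat -> mat2 N A) X i j k l :
  entry (prod12 1 1 F X) i j k l = F X 0%N 0%N i j k l.
Proof. by rewrite /prod12 /pairs enum1 entry_tprod1 entry_place. Qed.

Lemma entry_prod21 (A : pzRingType) (F : mat2 N A -> nat -> nat -> mat2 N A) X i j k l :
  entry (prod21 1 1 F X) i j k l = F (flip X) 0%N 0%N i j k l.
Proof. by rewrite /prod21 /pairs enum1 entry_tprod1 entry_place. Qed.

End TwoFactors.

(** * The R-matrices modulo h and with cleared denominators *)

Section NormalizedRMatrix.
Variables (C : fieldType) (N : nat) (phi : nat -> ratf C).
Local Notation ratfh := (ratfh C).
Local Notation zh := (zh C).

Lemma taylor0 (G : ratfh) : taylor 0 0 0 G = G.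
Proof.
apply/fpsP => n; rewrite /= fact0 muln1 expr0 divr1 ratc1 mul1r.
rewrite big_ord_recl big1 ?addr0 => [|i _]; last first.
  by rewrite lift0 expr0n mul0r ratc0 mul0r.
by rewrite expr0 fact0 divr1 ratc1 mul1r subn0.
Qed.

Lemma fcoef_exp0 (a : C) : fcoef (fps_exp a) 0 = 1.
Proof. by rewrite /= expr0 divr1. Qed.

Lemma fcoef_emb (a : fps C) k : fcoef (emb a) k = ratc (fcoef a k).
Proof. by []. Qed.

Lemma fcoef_kappa0 : fcoef (kappa C) 0 = 0.
Proof. by rewrite fcoefD fcoefN !fcoef_exp0 subrr. Qed.

Lemma fcoefM0 (A : comNzRingType) (f g : fps A) :
  fcoef (f * g) 0 = fcoef f 0 * fcoef g 0.
Proof. by rewrite fcoefM big_ord1. Qed.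

Lemma fcoef_natr0 (A : comNzRingType) n : fcoef (n%:R : fps A) 0 = n%:R.
Proof. exact: (rmorph_nat (@fps_cst A)). Qed.

Lemma fcoef_inv0 (F : fieldType) (f : fps F) : fcoef f 0 != 0 ->
  fcoef f^-1 0 = (fcoef f 0)^-1.
Proof. by move=> /fps_field_unit uf; exact: (rmorphV (@fps_cst F) uf). Qed.

Lemma fcoef_peval0 (p : {poly C}) (a : C) :
  fcoef (peval p (fps_exp a)) 0 = p.[1].
Proof.
rewrite horner_coef fcoef_sum; apply: eq_bigr => i _.
rewrite fcoefM0; congr (_ * _).
by rewrite -[LHS]/(fps_cst _) rmorphXn /fps_cst /= expr0 divr1.
Qed.

Lemma Rc0 (i j k l : 'I_N) : fcoef (Rc C i j k l) 0 = ((i == j) && (k == l))%:R.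
Proof.
rewrite !fcoefD !fcoefM0 fcoef_kappa0 mul0r addr0 fcoef_exp0 mul1r !fcoef_natr0.
by case: (_ && (k == l)) => //; case: (i == k); rewrite ?addr0 ?add0r.
Qed.

Lemma ratc_nat (b : bool) : ratc b%:R = b%:R :> ratf C.
Proof. by case: b; rewrite ?ratc0 ?ratc1. Qed.

Lemma Rh0 (i j k l : 'I_N) : fcoef (Rh C i j k l) 0 = ((i == j) && (k == l))%:R.
Proof. by rewrite fcoef_emb Rc0 ratc_nat. Qed.

Lemma subr1_ratz_neq0 : 1 - Defs.ratz C != 0.
Proof.
rewrite -tof1 -rmorphB tof_eq0 -size_poly_gt0 -opprB size_polyN.
by rewrite -[X in 'X - X]/(1%:P) size_XsubC.
Qed.

Lemma fcoef_1zh0 : fcoef (1 - zh) 0 = 1 - Defs.ratz C. Proof. by []. Qed.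
Lemma fcoef_1zeh0 : fcoef (1 - zh * emb (eh (-1))) 0 = 1 - Defs.ratz C.
Proof. by rewrite fcoefD fcoefN fcoefM0 fcoef_emb fcoef_exp0 ratc1 mulr1. Qed.

Lemma ratfh_unit (g : ratfh) : fcoef g 0 != 0 -> g \is a GRing.unit.
Proof. exact: fps_field_unit. Qed.

Lemma embM (a b : fps C) : emb (a * b) = emb a * emb b.
Proof. exact: rmorphM. Qed.

Lemma embB (a b : fps C) : emb (a - b) = emb a - emb b.
Proof. exact: rmorphB. Qed.

Hypothesis hphi : normalizing N phi.

(** Modulo h only r = 0 remains. Any fraction p/d representing [phi 0 = 1] has p = d with d(1) != 0,
    so the choice made in [at_q] does not matter. *)
Lemma fz0 : fcoef (fz phi) 0 = 1.
Proof.
case: hphi => phi0 _ _.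
rewrite /= big_ord1 expr0 mulr1 phi0 (_ : fcoef _ 0 = 1) ?ratc1 //.
rewrite /at_q; case: xgetP => [x _ [p [d [d1 e ->]]]|/(_ 1) []].
  have d0 : d != 0 by apply: contraNneq d1 => ->; rewrite horner0.
  have -> : p = d.
    apply: tof_inj; have td : tof d != 0 by rewrite tof_eq0.
    by rewrite -[RHS]mul1r e divfK.
  rewrite divrr //; apply: fps_field_unit; by rewrite fcoef_peval0.
exists 1, 1; rewrite hornerC oner_neq0 tof1 divr1; split=> //.
rewrite divrr //; apply: fps_field_unit; by rewrite fcoef_peval0 hornerC oner_neq0.
Qed.

Definition Rz_factor : ratfh :=
  emb (eh (- Defs.half C)) * (1 - zh) * fz phi / (1 - zh * emb (eh (-1))).

Lemma zh_units : (1 - zh \is a GRing.unit) /\ (1 - zh * emb (eh (-1)) \is a GRing.unit).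
Proof.
by split; apply: ratfh_unit; rewrite ?fcoef_1zh0 ?fcoef_1zeh0 subr1_ratz_neq0.
Qed.

Lemma Rz_factor0 : fcoef Rz_factor 0 = 1.
Proof.
rewrite /Rz_factor !fcoefM0 fcoef_inv0 ?fcoef_1zeh0 ?subr1_ratz_neq0 //.
by rewrite fcoef_emb fcoef_exp0 ratc1 fz0 mul1r mulr1 mulfV ?subr1_ratz_neq0.
Qed.

Lemma Rz_factor_unit : Rz_factor \is a GRing.unit.
Proof. by apply: ratfh_unit; rewrite Rz_factor0 oner_neq0. Qed.

Lemma RzE (i j k l : 'I_N) : Rz phi i j k l = Rz_factor * Rbar C i j k l :> ratfh.
Proof. by []. Qed.

Lemma Rz0 (i j k l : 'I_N) : fcoef (Rz phi i j k l : ratfh) 0 = ((i == j) && (k == l))%:R.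
Proof.
rewrite RzE fcoefM0 Rz_factor0 mul1r fcoefD Rh0 !fcoefM0.
by rewrite fcoef_emb fcoef_kappa0 ratc0 !mul0r addr0.
Qed.

(** The coefficient of z in (1 - z) Rbar(z). *)
Definition kR (i j k l : 'I_N) : fps C := kappa C * Pm _ i j k l - Rc C i j k l.

(** (1 - z) Rbar(z) *)
Definition Qz (i j k l : 'I_N) : ratfh := emb (Rc C i j k l) + zh * emb (kR i j k l).

Lemma Rz_Qz (i j k l : 'I_N) : (1 - zh) * Rz phi i j k l = Rz_factor * Qz i j k l.
Proof.
rewrite RzE mulrCA; congr (_ * _); rewrite /Rbar mulrDr.
have -> : (1 - zh) * (emb (kappa C) * zh / (1 - zh) * Pm ratfh i j k l) =
    emb (kappa C) * zh * Pm ratfh i j k l.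
  rewrite -[X in (1 - zh) * X]mulrA mulrCA; congr (_ * _).
  by rewrite mulrA divrr ?mul1r //; case: zh_units.
have embP : emb (Pm _ i j k l) = Pm ratfh i j k l.
  by rewrite /Pm; case: (_ && _); rewrite ?rmorph1 ?rmorph0.
rewrite /Qz /kR [emb (_ * _ - _)]embB [emb (_ * _)]embM embP /Rh.
by move: (emb (Rc _ _ _ _ _)) (emb (kappa C)) (Pm _ _ _ _ _) => x y p; ring.
Qed.

End NormalizedRMatrix.

(** * Matrix entries of the defining equation of sigma *)

Section SigmaIdentity.
Variables (C : fieldType) (N : nat) (phi : nat -> ratf C).
Hypothesis hphi : normalizing N phi.
Local Notation V := (Vac N phi).
Local Notation K := (ratfh C).
Local Notation t := (fun i j : 'I_N => @tplus C N phi i j 0).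

Lemma entry_T13 i j k l :
  entry (@Tplus C N phi _ [seq lshift 1 r | r <- enum 'I_1]) i j k l =
  if k == l then t i j else 0.
Proof.
rewrite /entry /Tplus enum1 /= big_seq1 mk2_0 mk2_0 ffunE.
rewrite (_ : [forall _, _] = (k == l)) //.
apply/forallP/eqP => [/(_ s1)|->]; first by rewrite !mk2_1 [e0 _ _]ffunE eqxx andbT inE => /eqP.
by apply: ord11P; rewrite inE ?eqxx // !mk2_1 [e0 _ _]ffunE !eqxx.
Qed.

Lemma entry_T24 i j k l :
  entry (@Tplus C N phi _ [seq rshift 1 r | r <- enum 'I_1]) i j k l =
  if i == j then t k l else 0.
Proof.
rewrite /entry /Tplus enum1 /= big_seq1 !mk2_1 ffunE.
rewrite (_ : [forall _, _] = (i == j)) //.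
apply/forallP/eqP => [/(_ s0)|->]; first by rewrite !mk2_0 [e0 _ _]ffunE eqxx andbT inE => /eqP.
by apply: ord11P; rewrite inE ?eqxx // !mk2_0 [e0 _ _]ffunE !eqxx.
Qed.

Lemma sum_if_eq (D : zmodType) (k : 'I_N) (F : 'I_N -> D) :
  \sum_b (if k == b then F b else 0) = F k.
Proof. by rewrite -big_mkcond (big_pred1 k) // => b; rewrite eq_sym. Qed.

Variable sigma : V -> V -> ten2 V.
Hypothesis hsigma : is_sigma sigma.

Lemma entry_TT i j k l : entry (TT 1 1 sigma) i j k l = sigma (t i j) (t k l).
Proof.
have [hm _] := hsigma.
have s0r u : sigma u 0 = 0.
  by apply: (addrI (sigma u 0)); rewrite -((hm.2 u).1 0 0) !addr0.
have s0l v : sigma 0 v = 0.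
  by apply: (addrI (sigma 0 v)); rewrite -((hm.1 v).1 0 0) !addr0.
rewrite /TT entry_tmul exchange_big.
under eq_bigr => b _ do under eq_bigr => a _ do rewrite entry_T13 entry_T24.
rewrite -[RHS](@sum_if_eq _ k (fun b => sigma (t i j) (t b l))); apply: eq_bigr => b _.
case: (k == b); last by rewrite big1.
rewrite -(@sum_if_eq _ j (fun a => sigma (t i a) (t b l))).
by apply: eq_bigr => a _; rewrite [a == j]eq_sym; case: (j == a).
Qed.

Lemma pureDl (u u' v : V) : pure (u + u') v = pure u v + pure u' v.
Proof.
apply/hlim_eqP => n /=; apply: tc_trans (tc_pureDl _ _ _ _) _.
by apply: tc_eq_add; apply: tc_sym; exact: (@hlim_reprP _ (ten_tower V)).
Qed.

Lemma pureDr (u v v' : V) : pure u (v + v') = pure u v + pure u v'.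
Proof.
apply/hlim_eqP => n /=; apply: tc_trans (tc_pureDr _ _ _ _) _.
by apply: tc_eq_add; apply: tc_sym; exact: (@hlim_reprP _ (ten_tower V)).
Qed.

Lemma pure0l (v : V) : pure 0 v = 0.
Proof. by apply: (addrI (pure 0 v)); rewrite -pureDl !addr0. Qed.
Lemma pure0r (u : V) : pure u 0 = 0.
Proof. by apply: (addrI (pure u 0)); rewrite -pureDr !addr0. Qed.

Lemma entry_TBT (B : tser N (1 + 1) K) i j k l : entry (TBT (phi := phi) 1 1 B) i j k l =
  \sum_a \sum_b entry B a j k b *: pure (t i a) (t b l).
Proof.
rewrite /TBT entry_tmul; apply: eq_bigr => a _.
under eq_bigr => b _ do rewrite entry_T13 entry_tmul !fct_sumE.
(* T^+13 is the identity on the second matrix factor, which forces k = b, and T^+24 on the first,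
   which forces c = j. *)
have E b : \sum_(c : 'I_N) (\sum_(d : 'I_N)
      (fun u : V => entry B a c b d *: pure u
         (entry (@Tplus C N phi _ [seq rshift 1 r | r <- enum 'I_1]) c j d l)))
      (if k == b then t i a else 0) =
    if k == b then \sum_d entry B a j b d *: pure (t i a) (t d l) else 0.
  transitivity (\sum_(c : 'I_N) if j == c then (if k == b then
      \sum_d entry B a c b d *: pure (t i a) (t d l) else 0) else 0); last first.
    exact: (@sum_if_eq _ j).
  apply: eq_bigr => c _; rewrite fct_sumE.
  under eq_bigr => d _ do rewrite entry_T24 [c == j]eq_sym.
  case: (j == c); last by rewrite big1 // => d _; rewrite pure0r scaler0.
  by case: (k == b) => //; rewrite big1 // => d _; rewrite pure0l scaler0.
under eq_bigr => b _ do rewrite E.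
exact: sum_if_eq.
Qed.

End SigmaIdentity.

Section SigmaRelation.
Variables (C : fieldType) (N : nat) (phi : nat -> ratf C).
Hypothesis hphi : normalizing N phi.
Local Notation V := (Vac N phi).
Local Notation K := (ratfh C).
Local Notation t := (fun i j : 'I_N => @tplus C N phi i j 0).
Local Notation R12 := (prod12 1 1 (@constF N K) (@Rh C N)).
Local Notation R21 := (prod21 1 1 (@constF N K) (@Rh C N)).
Local Notation R12z := (prod12 1 1 (expF 0) (@Rz C N phi)).
Local Notation R21z := (prod21 1 1 (expF 0) (@Rz C N phi)).

Lemma ratfh_tinvP (X : tser N (1 + 1) K) :
  (forall i j k l, fcoef (entry X i j k l) 0 = ((i == j) && (k == l))%:R) ->
  forall o : pred 'I_(1 + 1),
  tmul o *%R X (tinv o X) = tone K /\ tmul o *%R (tinv o X) X = tone K.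
Proof.
move=> hX o; apply: (@tinvP N (ratf C) o X) => i j; rewrite (mk2_eta i) (mk2_eta j).
by rewrite -[LHS]/(fcoef (entry X _ _ _ _) 0) hX mk2_inj.
Qed.

Lemma entry_R12 i j k l : entry R12 i j k l = Rh C i j k l.
Proof. by rewrite entry_prod12. Qed.
Lemma entry_R21 i j k l : entry R21 i j k l = Rh C k l i j.
Proof. by rewrite entry_prod21. Qed.
Lemma entry_R12z i j k l : entry R12z i j k l = Rz phi i j k l.
Proof. by rewrite entry_prod12 /expF taylor0. Qed.
Lemma entry_R21z i j k l : entry R21z i j k l = Rz phi k l i j.
Proof. by rewrite entry_prod21 /expF taylor0. Qed.

(** With commuting entries, LR is the multiplication opposite to RL. The RL-inverse of R can
    therefore be cleared from an LR-product by an LR-multiplication by R. *)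
Lemma tinv_R12 p a b q :
  \sum_i \sum_j entry (tinv (@RL 1 1) R12) i a b j * Rh C p i j q =
  ((p == a) && (b == q))%:R.
Proof.
have /ratfh_tinvP/(_ (@RL 1 1)) [_ h] i j k l :
    fcoef (entry R12 i j k l) 0 = ((i == j) && (k == l))%:R.
  by rewrite entry_R12 Rh0.
rewrite -entry_tone -h entry_tmulRL; apply: eq_bigr => i _; apply: eq_bigr => j _.
by rewrite entry_R12.
Qed.

Lemma tinv_R21z c j d q :
  \sum_a \sum_b entry (tinv pred0 R21z) c a d b * Rz phi b q a j =
  ((c == j) && (d == q))%:R.
Proof.
have /ratfh_tinvP/(_ pred0) [_ h] i k l m :
    fcoef (entry R21z i k l m) 0 = ((i == k) && (l == m))%:R.
  by rewrite entry_R21z (Rz0 hphi) andbC.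
rewrite -entry_tone -h entry_tmul; apply: eq_bigr => a _; apply: eq_bigr => b _.
by rewrite entry_R21z.
Qed.

Variable sigma : V -> V -> ten2 V.
Hypothesis hsigma : is_sigma sigma.

Lemma sigma_tplus i j k l : sigma (t i j) (t k l) =
  \sum_a \sum_b entry (tinv (@RL 1 1) R12) i a b l *:
     (\sum_c \sum_d entry (tinv pred0 R21z) c j d b *:
        (\sum_e \sum_f Rz phi a e k f *: entry (TBT (phi := phi) 1 1 R21) e c f d)).
Proof.
rewrite -(entry_TT hsigma); have [_ ->] := hsigma.
rewrite /sigma_rhs /lmulT /rmulT entry_tmulLR.
apply: eq_bigr => a _; apply: eq_bigr => b _; congr (_ *: _).
rewrite entry_tmul; apply: eq_bigr => c _; apply: eq_bigr => d _; congr (_ *: _).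
rewrite entry_tmul; apply: eq_bigr => e _; apply: eq_bigr => f _.
by rewrite entry_R12z.
Qed.

(** On these vectors no completion of the tensor square is involved, so [ten_lift] in the locality
    axiom can be replaced by [ten_lim]. *)
Lemma ten_finite_sigma i j k l : ten_finite (sigma (t i j) (t k l)).
Proof.
rewrite sigma_tplus.
do 3 (apply: ten_finite_sum => ? _; apply: ten_finite_sum => ? _; apply: ten_finiteZ).
rewrite entry_TBT; apply: ten_finite_sum => ? _; apply: ten_finite_sum => ? _.
by apply: ten_finiteZ; apply: ten_finite_pure.
Qed.

(* The constant term of the defining equation of sigma, with the inverses
   cleared; the normalizing factor of R(z) cancels. *)
Lemma sigma_exchange p j' k q' :
  \sum_j \sum_q Qz C q q' j j' *:
    (\sum_i \sum_l Rh C p i l q *: sigma (t i j) (t k l)) =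
  \sum_a \sum_b Qz C p a k b *:
    (\sum_x \sum_y Rh C b y x j' *: pure (t a x) (t y q')).
Proof.
rewrite (exchange_identity (Rz_factor_unit hphi) (Rz_Qz phi) tinv_R12 tinv_R21z
  sigma_tplus).
apply: eq_bigr => a _; apply: eq_bigr => b _; congr (_ *: _); rewrite entry_TBT.
by apply: eq_bigr => x _; apply: eq_bigr => y _; rewrite entry_R21.
Qed.

End SigmaRelation.

(** * The reflection equation *)

Section ReflectionEquation.
Variables (C : fieldType) (N : nat) (phi : nat -> ratf C).
Hypothesis hphi : normalizing N phi.
Local Notation V := (Vac N phi).
Local Notation t := (fun i j : 'I_N => @tplus C N phi i j 0).
Local Notation Rc := (@Rc C N).
Variables (W0 : lmodType C) (sigma : V -> V -> ten2 V).
Local Notation W := (fps W0).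
Variable YW : V -> int -> W -> W.
Hypothesis hsigma : is_sigma sigma.
Hypothesis YWl : forall v k, linear (YW v k).
Hypothesis YWlv : forall k w, linear (fun v => YW v k w).
Hypothesis YWh : forall v w, hlaurent (fun k => YW v k w).
Hypothesis YW1 : forall k w, YW 1 k w = if k == 0 then w else 0.
Hypothesis YWloc : locality sigma YW.
Hypothesis hpole : forall (i j : 'I_N) (k : int) (w : W),
  k < -1 -> YW (tgen phi i j 1) k w = 0.

Local Notation ell i j w := (YW (tgen phi i j 1) (-1) w).
Local Notation h := (fps_X C).
Local Notation slim := (sigma_lim YW).

Let YW0 k w : YW 0 k w = 0.
Proof. by have := YWlv k w (-1) 0 0; rewrite scaleN1r oppr0 addr0 scaleN1r addNr. Qed.
Let YWr0 v k : YW v k 0 = 0.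
Proof. by have := YWl v k (-1) 0 0; rewrite scaleN1r oppr0 addr0 scaleN1r addNr. Qed.

Lemma YW_tplus i j k w :
  YW (t i j) k w = (if (i == j) && (k == 0) then w else 0) - h *: YW (tgen phi i j 1) k w.
Proof.
have -> : t i j = (- h) *: tgen phi i j 1 + (i == j)%:R.
  by rewrite /tplus eqxx andbT scaleNr addrC.
rewrite YWlv scaleNr addrC; congr (_ - _).
by case: (i == j); rewrite /= ?YW1 ?YW0.
Qed.

Lemma YW_tplus_pole i j k w : k < -1 -> YW (t i j) k w = 0.
Proof.
move=> k1; rewrite YW_tplus hpole // scaler0 subr0.
by rewrite (_ : (k == 0) = false) ?andbF //; apply/eqP; lia.
Qed.

Lemma YW_tplus_res i j w : YW (t i j) (-1) w = - (h *: ell i j w).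
Proof. by rewrite YW_tplus andbF sub0r. Qed.

Section Entry.
Variables (p j' k q' : 'I_N) (w : W).

(* The two sides of [sigma_exchange] with the values of [F] in place of the
   vectors of the tensor square; multiplication by z = z1/z2 is the shift
   (a, b) -> (a - 1, b + 1). *)
Definition exch_l (F : 'I_N -> 'I_N -> 'I_N -> 'I_N -> int -> int -> W) (a b : int) :=
  \sum_j \sum_q
    (Rc q q' j j' *: (\sum_i \sum_l Rc p i l q *: F i j k l a b) +
     kR C q q' j j' *: (\sum_i \sum_l Rc p i l q *: F i j k l (a - 1) (b + 1))).

Definition exch_r (F : 'I_N -> 'I_N -> 'I_N -> 'I_N -> int -> int -> W) (a b : int) :=
  \sum_c \sum_d
    (Rc p c k d *: (\sum_x \sum_y Rc d y x j' *: F c x y q' a b) +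
     kR C p c k d *: (\sum_x \sum_y Rc d y x j' *: F c x y q' (a - 1) (b + 1))).

Lemma sigma_lim_Qz a b (R1 R2 : fps C) (x : ten2 V) :
  slim w a b ((emb R1 + zh C * emb R2) *: x) =
  R1 *: slim w a b x + R2 *: slim w (a - 1) (b + 1) x.
Proof.
rewrite scalerDl sigma_limD // sigma_limZ //; congr (_ + _).
by rewrite -scalerA sigma_lim_zh // sigma_limZ.
Qed.

(** The image of [sigma_exchange] under Y_W. Being linear in z, [Qz] only produces the exponents (a,
    b) and (a - 1, b + 1). *)
Lemma exchange_lim a b :
  exch_l (fun i j k l a b => slim w a b (sigma (t i j) (t k l))) a b =
  exch_r (fun i j k l a b => YW (t i j) a (YW (t k l) b w)) a b.
Proof.
have := congr1 (slim w a b) (sigma_exchange hphi hsigma p j' k q').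
rewrite !sigma_lim_sum // => e.
have slim2 (R : 'I_N -> 'I_N -> fps C) x y (F : 'I_N -> 'I_N -> ten2 V) :
    slim w x y (\sum_i \sum_l emb (R i l) *: F i l) =
    \sum_i \sum_l R i l *: slim w x y (F i l).
  rewrite sigma_lim_sum //; apply: eq_bigr => i _; rewrite sigma_lim_sum //.
  by apply: eq_bigr => l _; rewrite sigma_limZ.
have eL : \sum_i slim w a b (\sum_q Qz C q q' i j' *:
      (\sum_i0 \sum_l Rh C p i0 l q *: sigma (t i0 i) (t k l))) =
    exch_l (fun i j k l a b => slim w a b (sigma (t i j) (t k l))) a b.
  apply: eq_bigr => j _; rewrite sigma_lim_sum //; apply: eq_bigr => q _.
  by rewrite sigma_lim_Qz !slim2.
rewrite -eL e; apply: eq_bigr => c _.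
rewrite sigma_lim_sum //; apply: eq_bigr => d _; rewrite sigma_lim_Qz !slim2.
by congr (_ *: _ + _ *: _); apply: eq_bigr => x _; apply: eq_bigr => y _;
  rewrite sigma_lim_pure.
Qed.

Lemma zdiff_exch_l r F a b :
  zdiff r (exch_l F) a b = exch_l (fun i j k l => zdiff r (F i j k l)) a b.
Proof.
have z2 (R : 'I_N -> 'I_N -> fps C) (G : 'I_N -> 'I_N -> int -> int -> W) c d :
    zdiff r (fun a b => \sum_i \sum_l R i l *: G i l a b) c d =
    \sum_i \sum_l R i l *: zdiff r (G i l) c d.
  rewrite zdiff_sum; apply: eq_bigr => i _; rewrite zdiff_sum.
  by apply: eq_bigr => l _; rewrite zdiffZ.
rewrite /exch_l zdiff_sum; apply: eq_bigr => j _; rewrite zdiff_sum.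
apply: eq_bigr => q _; rewrite zdiffD !zdiffZ z2; congr (_ + _ *: _).
by rewrite (zdiff_shift r (-1) 1 (fun a b => \sum_i \sum_l _ *: F i j k l a b)) z2.
Qed.

Lemma exch_lB F G a b :
  exch_l (fun i j k l a b => F i j k l a b - G i j k l a b) a b =
  exch_l F a b - exch_l G a b.
Proof.
rewrite -sumrB; apply: eq_bigr => j _; rewrite -sumrB; apply: eq_bigr => q _.
rewrite opprD addrACA -!scalerBr; congr (_ *: _ + _ *: _);
  rewrite -sumrB; apply: eq_bigr => i _; rewrite -sumrB; apply: eq_bigr => l _;
  by rewrite scalerBr.
Qed.

Lemma exch_l_hdvd n F : (forall i j k l a b, hdvd n (F i j k l a b)) ->
  forall a b, hdvd n (exch_l F a b).
Proof.
move=> hF a b; apply: hdvd_sum => j _; apply: hdvd_sum => q _.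
by apply: hdvdD; apply: hdvdZ; apply: hdvd_sum => i _; apply: hdvd_sum => l _;
  apply: hdvdZ.
Qed.

Definition locdiff i j k l (a b : int) : W :=
  slim w a b (sigma (t i j) (t k l)) - YW (t k l) b (YW (t i j) a w).

(** Locality gives an exponent for each pair of vectors; the maximum over the finitely many pairs of
    entries serves them all. *)
Lemma locdiff_zdiff n : (0 < n)%N ->
  exists r, forall i j k l a b, hdvd n (zdiff r (locdiff i j k l) a b).
Proof.
move=> n0.
have hloc (x : 'I_N * 'I_N * ('I_N * 'I_N)) : exists r, forall a b,
    hdvd n (zdiff r (locdiff x.1.1 x.1.2 x.2.1 x.2.2) a b).
  case: x => -[i j] [k0 l] /=.
  have [r hr] := YWloc (t i j) (t k0 l) n0; exists r => a b.
  rewrite zdiffB; have := hr w a b; congr hdvd; congr (_ - _).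
  apply: zdiff_ext => c d.
  by rewrite -(sigma_lim_finite YWl YWlv YWh) //; apply: ten_finite_sigma.
have [r hr] := choice hloc.
exists (\max_x r x) => i j k0 l; apply: zdiff_hdvd_leq (hr ((i, j), (k0, l))).
exact: leq_bigmax.
Qed.

Definition exch_diff (a b : int) : W :=
  exch_l (fun i j k l a b => YW (t k l) b (YW (t i j) a w)) a b -
  exch_r (fun i j k l a b => YW (t i j) a (YW (t k l) b w)) a b.

(** By [exchange_lim], [exch_diff] is a combination of locality defects. Multiplication by (z_1 -
    z_2)^r commutes with that combination, including its factor z_1/z_2. *)
Lemma exch_diff_zdiff n : (0 < n)%N ->
  exists r, forall a b, hdvd n (zdiff r exch_diff a b).
Proof.
move=> /locdiff_zdiff[r hr]; exists r => a b.
have E c d : exch_diff c d = -1 *: exch_l locdiff c d.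
  by rewrite /locdiff exch_lB exchange_lim scaleN1r opprB.
rewrite (zdiff_ext _ _ _ E) zdiffZ zdiff_exch_l; apply: hdvdZ.
exact: exch_l_hdvd.
Qed.

Lemma exch_diff_pole a b : a < -1 -> exch_diff a b = 0.
Proof.
move=> a1; have a2 : a - 1 < -1 by lia.
rewrite /exch_diff [X in X - _]big1 ?[X in _ - X]big1 ?subr0 // => i _.
  rewrite big1 // => j _.
  by rewrite !big1 ?scaler0 ?addr0 // => x _; rewrite big1 // => y _;
    rewrite YW_tplus_pole ?scaler0.
rewrite big1 // => j _.
by rewrite !big1 ?scaler0 ?addr0 // => x _; rewrite big1 // => y _;
  rewrite [YW _ _ w]YW_tplus_pole ?YWr0 ?scaler0.
Qed.

(** For L the matrix of the residues, the coefficient of e_(p j') (x) e_(k q') in L_2 R L_1 R_21 - R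
    L_1 R_21 L_2, applied to w. *)
Definition refl_diff : W :=
  \sum_j \sum_q Rc q q' j j' *:
    (\sum_i \sum_l Rc p i l q *: ell k l (ell i j w)) -
  \sum_c \sum_d Rc p c k d *:
    (\sum_x \sum_y Rc d y x j' *: ell c x (ell y q' w)).

Lemma YW_res2 i j k0 l :
  YW (t i j) (-1) (YW (t k0 l) (-1) w) = h ^+ 2 *: ell i j (ell k0 l w).
Proof.
rewrite !YW_tplus_res -!scaleNr.
have := YWl (tgen phi i j 1) (-1) (- h) (ell k0 l w) 0.
by rewrite YWr0 !addr0 => ->; rewrite scalerA mulrNN.
Qed.

(** The [kR] terms are read at (-2, 0), beyond the pole in z_1, and vanish; each of the two residues
    in the other terms carries a factor -h. *)
Lemma exch_diff_res : exch_diff (-1) (-1) = h ^+ 2 *: refl_diff.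
Proof.
rewrite /exch_diff /refl_diff scalerBr; congr (_ - _); rewrite scaler_sumr;
  apply: eq_bigr => c _; rewrite scaler_sumr; apply: eq_bigr => d _;
  rewrite [X in _ + _ *: X]big1 ?scaler0 ?addr0.
- rewrite [RHS]scalerA [h ^+ 2 * _]mulrC -[RHS]scalerA; congr (_ *: _).
  rewrite scaler_sumr; apply: eq_bigr => x _.
  rewrite scaler_sumr; apply: eq_bigr => y _.
  by rewrite YW_res2 scalerA [RHS]scalerA mulrC.
- by move=> x _; rewrite big1 // => y _; rewrite [YW _ _ w]YW_tplus_pole ?YWr0 ?scaler0.
- rewrite [RHS]scalerA [h ^+ 2 * _]mulrC -[RHS]scalerA; congr (_ *: _).
  rewrite scaler_sumr; apply: eq_bigr => x _.
  rewrite scaler_sumr; apply: eq_bigr => y _.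
  by rewrite YW_res2 scalerA [RHS]scalerA mulrC.
- by move=> x _; rewrite big1 // => y _; rewrite YW_tplus_pole ?scaler0.
Qed.

Lemma refl_diff0 : refl_diff = 0.
Proof.
have h2 : h ^+ 2 *: refl_diff = 0.
  apply: hdvd_eq0 => n.
  (* Locality is stated for positive levels, hence n + 1. *)
  have [r hr] := exch_diff_zdiff (ltn0Sn n).
  apply: (@hdvd_leq _ _ _ n.+1) => //.
  (* The exponent of z_2 is raised by r to compensate (-z_2)^r, so the coefficient read is the one
     at (-1, -1). *)
  have := hr (-1) (-1 + r%:Z); rewrite zdiff_lowest => [|a b _ a1]; last first.
    exact: exch_diff_pole.
  rewrite addrK exch_diff_res => /(hdvdZ (fps_const ((-1) ^+ r))).
  have -> : fps_const ((-1) ^+ r) *: (fps_const ((-1) ^+ r) *: (h ^+ 2 *: refl_diff)) =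
      h ^+ 2 *: refl_diff.
    rewrite scalerA (_ : _ * _ = 1) ?scale1r // -[LHS]/(fps_mon _ 0 * fps_mon _ 0).
    by rewrite fps_monM -exprMn mulrNN mulr1 expr1n.
  by [].
(* W_0[[h]] has no h-torsion: coefficient m of [refl_diff] is coefficient m + 2 of its multiple by
   h^2. *)
apply/fpsP => m; move/fpsP/(_ m.+2): h2.
have -> : h ^+ 2 = fps_mon 1 2 by rewrite expr2 fps_monM mulr1.
by rewrite fcoef_monZ /= !subSS subn0 scale1r.
Qed.

End Entry.

Lemma refl_rel_ev n x y : refl_rel n x y -> forall w,
  hdvd n (alg_ev (fun g w => ell g.1 g.2 w) x w -
          alg_ev (fun g w => ell g.1 g.2 w) y w).
Proof.
case=> i j k l w; rewrite [X in hdvd n X](_ : _ = - refl_diff i j k l w).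
  by rewrite refl_diff0 oppr0; exact: hdvd0.
rewrite /refl_diff opprB; congr (_ - _).
(* For R L_1 R_21 L_2, the sums over a' and b have to be exchanged. *)
- rewrite alg_ev_sum; apply: eq_bigr => a _.
  rewrite alg_ev_sum.
  under eq_bigr => a' _ do rewrite alg_ev_sum.
  rewrite exchange_big; apply: eq_bigr => b _ /=.
  rewrite scaler_sumr; apply: eq_bigr => a' _; rewrite alg_ev_sum scaler_sumr.
  by apply: eq_bigr => b' _; rewrite scalerA.
(* For L_2 R L_1 R_21, the sums over a' and b' move outside those over a and b. *)
- rewrite alg_ev_sum.
  under eq_bigr => a _ do rewrite alg_ev_sum.
  rewrite exchange_big; apply: eq_bigr => a' _ /=.
  under eq_bigr => a _ do rewrite alg_ev_sum.
  under eq_bigr => a _ do under eq_bigr => b _ do rewrite alg_ev_sum.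
  under eq_bigr => a _ do rewrite exchange_big.
  rewrite exchange_big; apply: eq_bigr => b' _ /=.
  rewrite scaler_sumr; apply: eq_bigr => a _; rewrite scaler_sumr.
  by apply: eq_bigr => b _; rewrite scalerA mulrC.
Qed.

End ReflectionEquation.

Theorem theorem4p5 (R : realType) (N : nat) (hN : (0 < N)%N) (c : R[i])
    (phi : nat -> ratf R[i]) (hphi : normalizing N phi)
    (Tm Ti : 'I_N -> 'I_N -> int -> Vac N phi -> Vac N phi)
    (hTm : is_Tminus c Tm) (hTi : is_Tinverse Tm Ti)
    (Y : Vac N phi -> int -> Vac N phi -> Vac N phi)
    (hY : is_vertex_map c Ti Y)
    (sigma rho : Vac N phi -> Vac N phi -> ten2 (Vac N phi))
    (hsigma : is_sigma sigma) (hrho : is_rho c rho)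
    (W0 : lmodType R[i])
    (YW : Vac N phi -> int -> fps W0 -> fps W0)
    (hW : weak_module Y sigma rho YW)
    (hpole : forall (i j : 'I_N) (k : int) (w : fps W0),
       k < -1 -> YW (tgen phi i j 1) k w = 0) :
  exists act : OhMat R[i] N -> fps W0 -> fps W0,
    is_action act /\
    forall (i j : 'I_N) (w : fps W0),
      act (lgen R[i] i j) w = YW (tgen phi i j 1) (-1) w.
Proof.
case: hW => [[YWl YWlv] YWh YW1 _ YWloc].
pose op (g : 'I_N * 'I_N) w := YW (tgen phi g.1 g.2 1) (-1) w.
have opl g : linear (op g) by exact: YWl.
have opr n x y : refl_rel n x y -> forall w, hdvd n (alg_ev op x w - alg_ev op y w).
  exact: (refl_rel_ev hphi hsigma).
exists (alg_act op); split; last by move=> i j w; exact: alg_act_gen.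
split.
- exact: alg_act_linear.
- exact: alg_act_linearl.
- exact: alg_act1.
- exact: alg_actM.
Qed.
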